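(* Let $(X,\rho,\mu)$ be a doubling metric measure space with doubling constant $C_\mu$ which supports the weak $p$-Poincaré inequality, where $\nu=\log_2 C_\mu$ and $1<p<\nu$. Suppose that $\Omega\subset\widetilde\Omega\subset X$ are $(p,p)$-extension domains. Let $1<q<p^{\ast}=\frac{\nu p}{\nu-p}$. Then for every bounded extension operator $E_{\Omega,\widetilde\Omega}:S^{1,p}(\Omega)\to S^{1,p}(\widetilde\Omega)$, with norm $\|E_{\Omega,\widetilde\Omega}\|$, $$\lambda_{p,q}(\widetilde\Omega)\le\|E_{\Omega,\widetilde\Omega}\|^p\,\lambda_{p,q}(\Omega).$$
   Context: $(X,\rho,\mu)$ is a metric space $(X,\rho)$ with a Borel regular measure $\mu$ (balls have positive finite measure). It is doubling if there is a constant, the minimal one being denoted $C_\mu>0$, with $\mu(B(x,2r))\le C_\mu\,\mu(B(x,r))$ for all $x\in X$, $r>0$. A domain is a nonempty connected open set; a domain $\Omega\subset X$ is regarded as a metric measure space with the induced metric and measure. Upper gradients: for a function $f:Y\to\mathbb R$ on a metric measure space $Y$, a Borel function $g:Y\to[0,\infty]$ is a $p$-weak upper gradient of $f$ if $|f(\gamma(a))-f(\gamma(b))|\le\int_\gamma g\,ds$ for $p$-a.e. rectifiable curve $\gamma:[a,b]\to Y$, i.e. for all rectifiable curves outside a family of $p$-modulus zero. For $1<p<\infty$, if $f$ has a $p$-weak upper gradient in $L^p(Y)$, there is a minimal one, unique up to a set of measure zero, denoted $\nabla_{min}f$. Newtonian-Sobolev space: $N^{1,p}(Y)$, $1<p<\infty$,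 is the space of measurable $f:Y\to\mathbb R$ with $f\in L^p(Y)$ having a $p$-weak upper gradient in $L^p(Y)$, with norm $\|f\|_{N^{1,p}(Y)}=\|f\|_{L^p(Y)}+\|\nabla_{min}f\|_{L^p(Y)}$ (functions whose difference has norm zero are identified). Seminormed space: $S^{1,p}(Y)$ is the space of measurable $f:Y\to\mathbb R$ with $f\in L^1_{\mathrm{loc}}(Y)$ having a minimal $p$-weak upper gradient $\nabla_{min}f\in L^p(Y)$, with seminorm $\|f\|_{S^{1,p}(Y)}=\|\nabla_{min}f\|_{L^p(Y)}$. Weak $p$-Poincaré inequality: $X$ supports it if there are constants $\sigma>1$ and $C_p$ such that for all balls $B\subset X$, all $f\in L^1(\sigma B)$ and all $p$-weak upper gradients $g$ of $f$ in $\sigma B$, $$\frac1{\mu(B)}\int_B|f-f_B|\,d\mu\le C_p\,\mathrm{diam}(B)\left(\frac1{\mu(\sigma B)}\int_{\sigma B}g^p\,d\mu\right)^{1/p},$$ where $f_B=\frac1{\mu(B)}\int_B f\,d\mu$. Extension domains: a bounded domain $\Omega\subset X$ is a $(p,p)$-extension domain if there exists a bounded operator $E:S^{1,p}(\Omega)\to S^{1,p}(X)$ such that $E(f)|_\Omega=f$ for every $f\in S^{1,p}(\Omega)$. Likewise, for $\Omega\subset\widetilde\Omega$, a bounded extension operator $E_{\Omega,\widetilde\Omega}:S^{1,p}(\Omega)\to S^{1,p}(\widetilde\Omega)$ is a bounded operator with $E_{\Omega,\widetilde\Omega}(f)|_\Omega=f$ for all $f\in S^{1,p}(\Omega)$.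 Bounded means that for some finite $C$ one has $\|E_{\Omega,\widetilde\Omega}(f)\|_{S^{1,p}(\widetilde\Omega)}\le C\|f\|_{S^{1,p}(\Omega)}$ for all $f$ (and similarly for $E$), and the norm is $$\|E_{\Omega,\widetilde\Omega}\|=\sup_{f\in S^{1,p}(\Omega)}\frac{\|E_{\Omega,\widetilde\Omega}(f)\|_{S^{1,p}(\widetilde\Omega)}}{\|f\|_{S^{1,p}(\Omega)}},$$ the supremum being over $f$ with nonzero seminorm. Variational Neumann eigenvalue: for a domain $D\subset X$, $$\lambda_{p,q}(D)=\inf\left\{\frac{\|\nabla_{min} u\|_{L^p(D)}^p}{\|u\|_{L^q(D)}^p} : u\in N^{1,p}(D)\setminus\{0\},\ \int_D |u|^{q-2}u\,d\mu=0\right\}.$$ *)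

(* Defs.v *)
From HB Require Import structures.
From mathcomp Require Import all_boot all_order all_algebra.
From mathcomp Require Import all_classical all_reals all_analysis.
From mathcomp Require Import measurable_realfun.

Set Implicit Arguments.
Unset Strict Implicit.
Unset Printing Implicit Defensive.

Import Order.TTheory GRing.Theory Num.Theory.
Import numFieldNormedType.Exports.

Local Open Scope classical_set_scope.
Local Open Scope ring_scope.

(* Nonempty metric spaces; the base point is only there because the sigma-algebra
   constructions of the library are stated for pointed types. *)
#[short(type="pmetricType")]
HB.structure Definition PMetric (K : numDomainType) :=
  {T of Pointed T & Metric K T}.

(* A metric measure space is a pmetricType X with an outer measure mu on X.
   Measurable sets and integrals refer to the Caratheodory sigma-algebra of mu;
   "Borel" refers to the sigma-algebra generated by the open sets.
   A domain or a ball, seen as a metric measure space Y, is an open set D of X: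
   functions on Y are functions on X of which only the values on D matter. *)

Section MetricMeasure.
Context {R : realType} {X : pmetricType R}.
Variable mu : {outer_measure set X -> \bar R}.

Definition borel_regular : Prop :=
  (forall A : set X, <<s open >> A -> mu.-caratheodory A) /\
  (forall A : set X, exists B : set X, [/\ <<s open >> B, A `<=` B & mu B = mu A]).

Definition balls_pos_fin : Prop :=
  forall (x : X) (r : R), 0 < r -> (0 < mu (ball x r) < +oo)%E.

Definition doubling_with (C : R) : Prop :=
  0 < C /\ forall (x : X) (r : R), 0 < r ->
    (mu (ball x (2 * r)) <= C%:E * mu (ball x r))%E.

Definition doubling : Prop := exists C : R, doubling_with C.

Definition doubling_const : R := inf [set C | doubling_with C].

Definition doubling_dim : R := ln doubling_const / ln 2.

Definition cmeasure : {measure set (caratheodory_type mu) -> \bar R} :=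
  (mu : set (caratheodory_type mu) -> \bar R).

Definition mu_measurable_fun (D : set X) (f : X -> R) : Prop :=
  measurable_fun (D : set (caratheodory_type mu)) (f : caratheodory_type mu -> R).

Definition borel_fun (D : set X) (g : X -> \bar R) : Prop :=
  measurable_fun (D : set (g_sigma_algebraType (@open X)))
    (g : g_sigma_algebraType (@open X) -> \bar R).

Definition normLp (D : set X) (p : R) (f : X -> \bar R) : \bar R :=
  'N[cmeasure]_(p%:E)[f \_ D].

End MetricMeasure.

Section Curves.
Context {R : realType} {X : pmetricType R}.

Record curve := Curve {
  lo : R;
  hi : R;
  cfun :> R -> X;
  lo_le_hi : lo <= hi;
  cfun_continuous : {within `[lo, hi], continuous cfun} }.

Definition curve_in (D : set X) (c : curve) : Prop :=
  forall t, t \in `[lo c, hi c] -> D (c t).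

Definition polygonal_length (h : R -> X) (a b : R) (s : seq R) : R :=
  let F := h \o nth b (a :: s) in \sum_(0 <= n < size s) mdist (F n) (F n.+1).

Definition arc_length (h : R -> X) (a b : R) : \bar R :=
  ereal_sup [set (polygonal_length h a b s)%:E | s in itv_partition a b].

Definition curve_length (c : curve) : \bar R := arc_length c (lo c) (hi c).

Definition rectifiable (c : curve) : Prop := (curve_length c < +oo)%E.

(* Parametrization of c by arc length on [0, length of c]: its value at u is c t
   for any parameter t such that c has length u on [lo c, t]. *)
Definition arc_param (c : curve) (u : R) : X :=
  c (xget (lo c)
       [set t | t \in `[lo c, hi c] /\ arc_length c (lo c) t = u%:E]).

Definition curve_integral (c : curve) (g : X -> \bar R) : \bar R :=
  (\int[lebesgue_measure]_(u in `[0%R, fine (curve_length c)])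
     g (arc_param c u))%E.

End Curves.
Arguments curve {R} X.

Section Sobolev.
Context {R : realType} {X : pmetricType R}.
Variables (mu : {outer_measure set X -> \bar R}) (p : R).

Definition admissible (D : set X) (G : set (curve X)) (rho : X -> \bar R) :=
  [/\ borel_fun D rho, forall x, D x -> (0 <= rho x)%E &
    forall c, G c -> rectifiable c -> (1 <= curve_integral c rho)%E].

Definition modulus (D : set X) (G : set (curve X)) : \bar R :=
  ereal_inf [set (\int[cmeasure mu]_(x in D) (rho x `^ p))%E
            | rho in admissible D G].

Definition weak_upper_gradient (D : set X) (f : X -> R) (g : X -> \bar R) :=
  [/\ borel_fun D g, forall x, D x -> (0 <= g x)%E &
    exists G : set (curve X), [/\ G `<=` curve_in D, modulus D G = 0%E &
      forall c, curve_in D c -> rectifiable c -> ~ G c ->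
        (`|f (c (lo c)) - f (c (hi c))|%:E <= curve_integral c g)%E]].

Definition minimal_gradient (D : set X) (f : X -> R) (g : X -> \bar R) :=
  [/\ weak_upper_gradient D f g, (normLp mu D p g < +oo)%E &
    forall h, weak_upper_gradient D f h -> (normLp mu D p h < +oo)%E ->
      {ae cmeasure mu, forall x, D x -> (g x <= h x)%E}].

(* A representative of the minimal p-weak upper gradient. *)
Definition mingrad (D : set X) (f : X -> R) : X -> \bar R :=
  xget (cst 0%E) [set g | minimal_gradient D f g].

Definition N1p (D : set X) (f : X -> R) :=
  [/\ mu_measurable_fun mu D f, (normLp mu D p (EFin \o f) < +oo)%E &
    exists2 g, weak_upper_gradient D f g & (normLp mu D p g < +oo)%E].

Definition N1p_norm (D : set X) (f : X -> R) : \bar R :=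
  (normLp mu D p (EFin \o f) + normLp mu D p (mingrad D f))%E.

Definition loc_integrable (D : set X) (f : X -> R) :=
  forall x, D x -> exists2 r : R, 0 < r &
    (cmeasure mu).-integrable (D `&` ball x r) (EFin \o f).

Definition S1p (D : set X) (f : X -> R) :=
  [/\ mu_measurable_fun mu D f, loc_integrable D f &
    exists g, minimal_gradient D f g].

Definition S1p_seminorm (D : set X) (f : X -> R) : \bar R :=
  normLp mu D p (mingrad D f).

Definition diameter (A : set X) : \bar R :=
  ereal_sup [set (mdist z.1 z.2)%:E | z in A `*` A].

Definition ball_mean (x : X) (r : R) (f : X -> R) : R :=
  fine ((\int[cmeasure mu]_(y in ball x r) (f y)%:E) / mu (ball x r))%E.

Definition weak_poincare : Prop :=
  exists sigma C : R, 1 < sigma /\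
    forall (x : X) (r : R) (f : X -> R) (g : X -> \bar R), 0 < r ->
      (cmeasure mu).-integrable (ball x (sigma * r)) (EFin \o f) ->
      weak_upper_gradient (ball x (sigma * r)) f g ->
      ((\int[cmeasure mu]_(y in ball x r) `|f y - ball_mean x r f|%:E)
         / mu (ball x r)
       <= C%:E * diameter (ball x r) *
          ((\int[cmeasure mu]_(y in ball x (sigma * r)) (g y `^ p))
             / mu (ball x (sigma * r))) `^ p^-1)%E.

Definition domain (D : set X) : Prop := [/\ D !=set0, open D & connected D].

Definition metric_bounded (D : set X) : Prop :=
  exists (x : X) (r : R), D `<=` ball x r.

(* E acts on functions on D and yields functions on D': the first clause says
   that E f on D' only depends on f on D. Linearity of E is not required. *)
Definition bounded_extension (D D' : set X) (E : (X -> R) -> (X -> R)) : Prop :=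
  [/\ forall f g, S1p D f -> S1p D g ->
        (forall x, D x -> f x = g x) -> forall x, D' x -> E f x = E g x,
      forall f, S1p D f -> S1p D' (E f),
      forall f, S1p D f -> forall x, D x -> E f x = f x &
      exists C : R, forall f, S1p D f ->
        (S1p_seminorm D' (E f) <= C%:E * S1p_seminorm D f)%E].

Definition extension_norm (D D' : set X) (E : (X -> R) -> (X -> R)) : \bar R :=
  ereal_sup [set (S1p_seminorm D' (E f) / S1p_seminorm D f)%E
            | f in [set f | S1p D f /\ S1p_seminorm D f != 0%E]].

Definition extension_domain (D : set X) : Prop :=
  [/\ domain D, metric_bounded D & exists E, bounded_extension D setT E].

(* The integral constraint implies integrability of |u|^(q-2) u on D: in \bar R
   the difference of two infinite integrals is -oo. *)
Definition neumann_eigenvalue (q : R) (D : set X) : \bar R :=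
  ereal_inf [set (normLp mu D p (mingrad D u) `^ p
                  / normLp mu D q (EFin \o u) `^ p)%E
            | u in [set u | [/\ N1p D u, N1p_norm D u != 0%E &
                (\int[cmeasure mu]_(x in D)
                   ((`|u x| `^ (q - 2)) * u x)%:E = 0)%E]]].

End Sobolev.

(* Main.v *)
Require Import Defs.
From mathcomp Require Import all_boot all_order all_algebra.
From mathcomp Require Import all_classical all_reals all_analysis.
From mathcomp Require Import measurable_realfun.
From mathcomp Require Import ring lra.

(* Let u be admissible for the eigenvalue of D and let v = E u. Truncate v at
   height N and subtract the constant c for which the result is centered on D'.
   This does not increase the seminorm, so it remains to bound the L^q norm of
   T_N v - c over D' from below by that of T_N u - c over D. By Young's
   inequality |x|^q <= |x - c|^q + q c |x|^(q-2) x, and since the integral of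
   |u|^(q-2) u over D vanishes, this norm has a lower limit of at least the norm
   of u, uniformly in c. Truncation makes Sobolev embeddings superfluous, also
   when u is not in L^q.

   To apply E to u, one needs that u has a minimal weak upper gradient. It is
   the infimum of a minimizing sequence, once weak upper gradients are known to
   be stable under minima: along almost every curve two bounds for the increments
   of u may be pasted along any Borel set of parameters. The extension norm is
   positive since otherwise the Poincare inequality would reduce X to a point. *)

Set Implicit Arguments.
Unset Strict Implicit.
Unset Printing Implicit Defensive.

Import Order.TTheory GRing.Theory Num.Theory.
Import numFieldNormedType.Exports.

Local Open Scope classical_set_scope.
Local Open Scope ring_scope.

(** * Arc length *)

(** The definition of a weak upper gradient bounds increments between the endpoints of a curve only,
    and an exceptional family need not contain the curves that have a subcurve in it. Pasting,
    however, needs the bounds on all subcurves. Exceptional families are therefore traded for a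
    weight [rho] with finite p-energy (Fuglede's lemma): finiteness of the integral of [rho] passes
    from a curve to its subcurves, and countably many weights merge into one.

    [arc_param] picks a parameter by choice, so nothing can be said about it until every value
    between 0 and the total length is known to be attained.

    The center c of the truncated extension is known only once the height N is fixed, and no bound
    on it independent of N is at hand; hence the demand for uniformity in c. If u is not in $L^q$,
    its quotient is 0 and the claim becomes that the eigenvalue of D' vanishes; lower bounds by
    arbitrarily large numbers L give this too. *)

Section PolygonalLength.
Context {R : realType} {X : pmetricType R}.
Implicit Types (h : R -> X) (a b m : R) (s t : seq R).

Lemma polygonal_length_cons h a b x s :
  polygonal_length h a b (x :: s) = mdist (h a) (h x) + polygonal_length h x b s.
Proof. by rewrite /polygonal_length /= big_nat_recl. Qed.

Lemma polygonal_length_cat h a m b s t : last a s = m ->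
  polygonal_length h a b (s ++ t) =
  polygonal_length h a m s + polygonal_length h m b t.
Proof.
elim: s a => [a /= ->|x s IH a /= lastm].
  by rewrite {2}/polygonal_length /= big_geq// add0r.
by rewrite !polygonal_length_cons (IH _ lastm) addrA.
Qed.

Lemma polygonal_length_le h (V : R -> R) a b s :
  (forall x y, a <= x -> x <= y -> y <= b -> mdist (h x) (h y) <= V y - V x) ->
  itv_partition a b s -> polygonal_length h a b s <= V b - V a.
Proof.
elim: s a => [a _ /itv_partition_nil ->|x s IH a hV pxs].
  by rewrite /polygonal_length /= big_geq// subrr.
have ax : a <= x by case: pxs => /= /andP[/ltW].
have pxb := itv_partition_cons pxs.
have xb := itv_partition_le pxb.
rewrite polygonal_length_cons.
have := hV a x (lexx _) ax xb.
have := IH x (fun y z xy => hV y z (le_trans ax xy)) pxb.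
lra.
Qed.

(** The increments of [V] telescope along a partition. Below, [V] is a modified length function:
    comparing it with the length itself yields additivity and the absence of gaps. *)
Lemma arc_length_le h (V : R -> R) a b :
  (forall x y, a <= x -> x <= y -> y <= b -> mdist (h x) (h y) <= V y - V x) ->
  (arc_length h a b <= (V b - V a)%:E)%E.
Proof.
move=> hV; apply: ge_ereal_sup => _ [s ps <-].
by rewrite lee_fin; exact: polygonal_length_le.
Qed.

Lemma mdist_le_arc_length h a b : a <= b ->
  ((mdist (h a) (h b))%:E <= arc_length h a b)%E.
Proof.
rewrite le_eqVlt => /predU1P[<-|ab].
  apply: ereal_sup_ubound; exists [::]; first by split=> /=.
  by rewrite /polygonal_length big_geq// mdistxx.
apply: ereal_sup_ubound; exists [:: b]; first exact: itv_partition1.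
by rewrite polygonal_length_cons /polygonal_length big_geq// addr0.
Qed.

Lemma arc_length_ge0 h a b : a <= b -> (0 <= arc_length h a b)%E.
Proof.
by move=> ab; apply: le_trans (mdist_le_arc_length h ab); rewrite lee_fin mdist_ge0.
Qed.

(** Partitions of the two pieces concatenate. The two suprema are taken one after the other, each
    time moving the other term across the inequality; in [\bar R] the second move requires
    [amfin]. *)
Lemma arc_length_superadditive h a m b : a <= m -> m <= b ->
  (arc_length h a b < +oo)%E ->
  (arc_length h a m + arc_length h m b <= arc_length h a b)%E.
Proof.
move=> am mb Lfin.
have cat s t : itv_partition a m s -> itv_partition m b t ->
    ((polygonal_length h a m s)%:E + (polygonal_length h m b t)%:E <=
     arc_length h a b)%E.
  move=> ps pt; apply: ereal_sup_ubound; exists (s ++ t).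
    exact: itv_partition_cat ps pt.
  by rewrite -EFinD; congr EFin; apply: polygonal_length_cat; case: ps => _ /eqP.
have left t : itv_partition m b t ->
    (arc_length h a m <= arc_length h a b - (polygonal_length h m b t)%:E)%E.
  move=> pt; apply: ge_ereal_sup => _ [s ps <-].
  by rewrite leeBrDr//; exact: cat.
have amfin : arc_length h a m \is a fin_num.
  rewrite ge0_fin_numE ?arc_length_ge0//.
  have [t pt] : exists t, itv_partition m b t.
    move: mb; rewrite le_eqVlt => /predU1P[->|mb']; first by exists [::].
    by exists [:: b]; exact: itv_partition1.
  apply: le_lt_trans (left t pt) _.
  by rewrite lteBlDr// lt_adde_def ?ltry.
rewrite addeC -leeBrDr//.
apply: ge_ereal_sup => _ [t pt <-].
rewrite leeBrDr// addeC -leeBrDr//; exact: left.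
Qed.

End PolygonalLength.

(** * The length function of a rectifiable curve and its arc length parametrization *)

Section RectifiableCurve.
Context {R : realType} {X : pmetricType R}.
Variable c : curve X.
Hypothesis rect : rectifiable c.

Definition len (t : R) : R := fine (arc_length c (lo c) t).

Lemma arc_length_lo t : lo c <= t -> t <= hi c ->
  arc_length c (lo c) t = (len t)%:E.
Proof.
move=> lt th; rewrite fineK// ge0_fin_numE ?arc_length_ge0//.
apply: le_lt_trans rect; apply: le_trans (arc_length_superadditive lt th rect).
by rewrite leeDl// arc_length_ge0.
Qed.

Lemma len_lo : len (lo c) = 0.
Proof.
apply/eqP; rewrite eq_le -!lee_fin -arc_length_lo ?lexx ?lo_le_hi//.
rewrite arc_length_ge0// andbT.
have := @arc_length_le _ _ c (fun=> 0) (lo c) (lo c); rewrite subrr; apply.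
by move=> x y lx xy yl; rewrite (_ : x = y) ?mdistxx ?subrr//; lra.
Qed.

Lemma curve_length_len : curve_length c = (len (hi c))%:E.
Proof. by rewrite -arc_length_lo ?lexx ?lo_le_hi. Qed.

Lemma arc_length_le_len s t : lo c <= s -> s <= t -> t <= hi c ->
  (arc_length c s t <= (len t - len s)%:E)%E.
Proof.
move=> ls st th; rewrite EFinB leeBrDr//.
rewrite -!arc_length_lo //; [|lra|lra].
rewrite addeC; apply: arc_length_superadditive => //.
by rewrite arc_length_lo ?(le_trans ls)// ltry.
Qed.

Lemma mdist_le_len s t : lo c <= s -> s <= t -> t <= hi c ->
  mdist (c s) (c t) <= len t - len s.
Proof.
move=> ls st th; rewrite -lee_fin.
exact: le_trans (mdist_le_arc_length _ st) (arc_length_le_len ls st th).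
Qed.

Lemma len_mono s t : lo c <= s -> s <= t -> t <= hi c -> len s <= len t.
Proof.
by move=> ls st th; rewrite -subr_ge0 (le_trans _ (mdist_le_len ls st th))// mdist_ge0.
Qed.

Lemma len_ge0 t : lo c <= t -> t <= hi c -> 0 <= len t.
Proof. by move=> lt th; rewrite -len_lo len_mono. Qed.

(** Superadditivity gives one inequality. For the other, [V] follows [len] up to [s] and from there
    adds the length of the piece starting at [s]; it dominates distances, across [s] by the triangle
    inequality, hence also the length up to [t]. *)
Lemma arc_length_len s t : lo c <= s -> s <= t -> t <= hi c ->
  arc_length c s t = (len t - len s)%:E.
Proof.
move=> ls st th; apply/eqP; rewrite eq_le arc_length_le_len//=.
have sfin : arc_length c s t \is a fin_num.
  rewrite ge0_fin_numE ?arc_length_ge0//.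
  exact: le_lt_trans (arc_length_le_len ls st th) (ltry _).
pose V x := if x <= s then len x else len s + fine (arc_length c s x).
have : (arc_length c (lo c) t <= (V t - V (lo c))%:E)%E.
  have sx x : s <= x -> x <= t ->
      arc_length c s x = (fine (arc_length c s x))%:E.
    move=> sx xt; rewrite fineK// ge0_fin_numE ?arc_length_ge0//.
    by apply: le_lt_trans (arc_length_le_len ls sx (le_trans xt th)) (ltry _).
  have step x y : s <= x -> x <= y -> y <= t ->
      mdist (c x) (c y) <=
      fine (arc_length c s y) - fine (arc_length c s x).
    move=> sx' xy yt.
    have xt := le_trans xy yt; have sy := le_trans sx' xy.
    have := arc_length_superadditive sx' xy (h := c).
    rewrite (sx _ sy yt) (sx _ sx' xt) => /(_ (ltry _)) le1.
    have := le_trans (leeD2l _ (mdist_le_arc_length c xy)) le1.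
    by rewrite lee_fin; lra.
  have ss : fine (arc_length c s s) = 0.
    apply/eqP; rewrite eq_le fine_ge0 ?arc_length_ge0// andbT.
    rewrite -lee_fin -sx ?lexx// (le_trans (arc_length_le_len ls (lexx s) _)) ?subrr//.
    lra.
  apply: arc_length_le => x y lx xy yt; rewrite /V.
  case: (leP y s) => ys; first by rewrite ifT ?mdist_le_len//; lra.
  case: (leP x s) => xs; last by have := step x y (ltW xs) xy yt; lra.
  have h1 := step s y (lexx s) (ltW ys) yt.
  have h2 := mdist_le_len lx xs (le_trans st th).
  have h3 := metric_triangle (c x) (c s) (c y).
  by rewrite ss in h1; lra.
have lt : lo c <= t by lra.
rewrite arc_length_lo// /V ls len_lo subr0 lee_fin.
case: ifP => ts; last first.
  by rewrite -[X in (_ <= X)%E]fineK// lee_fin; lra.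
have -> : t = s by lra.
by move=> _; rewrite subrr arc_length_ge0.
Qed.

Lemma curve_continuous_at t : t \in `[lo c, hi c] -> forall e : R, 0 < e ->
  exists2 d : R, 0 < d & forall s, s \in `[lo c, hi c] -> `|t - s| < d ->
    mdist (c t) (c s) < e.
Proof.
move=> tI e e0.
have /subspace_continuousP/(_ t tI) := @cfun_continuous _ _ c.
move=> /metricType_numDomainType.cvgrPdist_lt/(_ _ e0).
rewrite near_withinE /= => -[d /= d0 H]; exists d => // s sI ts.
exact: H.
Qed.

(* A missed value u would leave a gap of some size d in the length function;
   subtracting d beyond the gap still dominates the metric, against the
   minimality of the length. *)
Lemma len_attained u : 0 <= u -> u <= len (hi c) ->
  exists2 t, t \in `[lo c, hi c] & len t = u.
Proof.
move=> u0 uL; apply/not_exists2P => nou.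
have lh := lo_le_hi c.
have {}nou t : lo c <= t -> t <= hi c -> len t != u.
  move=> lt th; apply/eqP => tu.
  by case: (nou t); apply => //; rewrite in_itv/= lt th.
have hiu : u < len (hi c) by rewrite lt_neqAle uL eq_sym nou.
have lou : len (lo c) < u by rewrite lt_neqAle nou// len_lo.
pose S := [set t | [/\ lo c <= t, t <= hi c & len t < u]].
have Slo : S (lo c) by split.
have Sub : ubound S (hi c) by move=> t [].
have supS : has_sup S by split; [exists (lo c) | exists (hi c)].
pose t0 := sup S.
have lt0 : lo c <= t0 by apply: ub_le_sup => //; exists (hi c).
have t0h : t0 <= hi c by apply: ge_sup => //; exists (lo c).
have before x : lo c <= x -> x < t0 -> len x < u.
  move=> lx xt0; have [y [ly yh yu] xy] := sup_adherent (eps := t0 - x) ltac:(lra) supS.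
  by rewrite -/t0 in xy; apply: le_lt_trans yu; apply: len_mono => //; lra.
have after x : t0 < x -> x <= hi c -> u < len x.
  move=> t0x xh; rewrite ltNge le_eqVlt; apply/negP => /orP[|xu].
    by apply/negP; apply: nou; lra.
  have : x <= t0 by apply: ub_le_sup; [exists (hi c) | split => //; lra].
  lra.
have left x : lo c <= x -> x <= hi c -> len x < u -> x <= t0.
  by move=> lx xh xu; apply: ub_le_sup; [exists (hi c) | split].
have right x : lo c <= x -> x <= hi c -> u < len x -> t0 <= x.
  move=> lx xh xu; rewrite leNgt; apply/negP => /(before _ lx); lra.
(* The length jumps over [u] at [t0]. If [len t0] exceeds [u], the jump is on the left and [d] is
   [len t0 - u]; otherwise it is on the right and [d] is [u - len t0]. Since [c] is continuous at
   [t0], passing to a parameter just before (or after) [t0] costs at most [e] in distance, whereas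
   the length changes by at least [d]. *)
have [d d0 gap] : exists2 d : R, 0 < d & forall s t, lo c <= s -> s <= t ->
    t <= hi c -> len s < u -> u < len t -> mdist (c s) (c t) <= len t - len s - d.
  have t0I : t0 \in `[lo c, hi c] by rewrite in_itv/= lt0 t0h.
  case: (ltP (len t0) u) => t0u; last first.
    have {}t0u : u < len t0 by rewrite lt_neqAle t0u eq_sym nou.
    exists (len t0 - u); first by lra.
    move=> s t ls st th su ut; apply/ler_addgt0Pr => e e0.
    have [d d0 cd] := curve_continuous_at t0I e0.
    have st0 : s < t0.
      rewrite lt_neqAle left// ?andbT; last exact: le_trans th.
      by apply/eqP => s0; move: su; rewrite s0; lra.
    have t0t : t0 <= t by apply: right => //; lra.
    pose s' := Num.max s (t0 - d / 2).
    have ss' : s <= s' by rewrite le_max lexx.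
    have s't0 : s' < t0 by rewrite gt_max st0/=; lra.
    have s'd : t0 - d / 2 <= s' by rewrite le_max lexx orbT.
    have s'u := before s' ltac:(lra) s't0.
    have h1 := mdist_le_len ls ss' ltac:(lra).
    have h2 := mdist_le_len lt0 t0t th.
    have h3 : mdist (c t0) (c s') < e.
      by apply: cd; [rewrite in_itv/=; apply/andP; split|rewrite ger0_norm]; lra.
    rewrite metric_sym in h3.
    have h4 := metric_triangle (c s) (c s') (c t).
    have h5 := metric_triangle (c s') (c t0) (c t).
    lra.
  exists (u - len t0); first by lra.
  move=> s t ls st th su ut; apply/ler_addgt0Pr => e e0.
  have [d d0 cd] := curve_continuous_at t0I e0.
  have st0 : s <= t0 by apply: left => //; lra.
  have t0t : t0 < t.
    rewrite lt_neqAle right// ?andbT; last lra.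
    by apply/eqP => s0; move: ut; rewrite -s0; lra.
  pose t' := Num.min t (t0 + d / 2).
  have t't : t' <= t by rewrite ge_min lexx.
  have t0t' : t0 < t' by rewrite lt_min t0t/=; lra.
  have t'd : t' <= t0 + d / 2 by rewrite ge_min lexx orbT.
  have t'u := after t' t0t' ltac:(lra).
  have h1 := mdist_le_len (ltac:(lra) : lo c <= t') t't th.
  have h2 := mdist_le_len ls st0 t0h.
  have h3 : mdist (c t0) (c t') < e.
    apply: cd; first by rewrite in_itv/=; apply/andP; split; lra.
    by rewrite distrC ger0_norm; lra.
  have h4 := metric_triangle (c s) (c t0) (c t).
  have h5 := metric_triangle (c t0) (c t') (c t).
  lra.
pose V x := if len x < u then len x else len x - d.
have : (arc_length c (lo c) (hi c) <= (V (hi c) - V (lo c))%:E)%E.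
  apply: arc_length_le => x y lx xy yh; rewrite /V.
  have xyL := len_mono lx xy yh.
  have := mdist_le_len lx xy yh.
  case: ltP => yu; case: ltP => xu; [by [] | lra | move=> _ | lra].
  have {}yu : u < len y by rewrite lt_neqAle yu eq_sym nou//; lra.
  by have := gap x y lx xy yh xu yu; lra.
rewrite arc_length_lo// lee_fin /V lou ltNge (ltW hiu)/= len_lo; lra.
Qed.

(** The choice made in [arc_param] is harmless: distances are at most differences of lengths, so
    parameters with the same length give the same point. *)
Lemma arc_param_len t : lo c <= t -> t <= hi c -> arc_param c (len t) = c t.
Proof.
move=> lt th; rewrite /arc_param.
case: xgetP => [s _ [] |/(_ t)]; last first.
  by case; split; [rewrite in_itv/= lt th | exact: arc_length_lo].
rewrite in_itv/= => /andP[ls sh].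
rewrite arc_length_lo// => -[sE]; apply: mdist_positivity; apply/eqP.
rewrite eq_le mdist_ge0 andbT.
case: (leP s t) => st; first by have := mdist_le_len ls st th; lra.
by have := mdist_le_len lt (ltW st) sh; rewrite metric_sym; lra.
Qed.

Lemma arc_param_lipschitz u v : 0 <= u -> u <= v -> v <= len (hi c) ->
  mdist (arc_param c u) (arc_param c v) <= v - u.
Proof.
move=> u0 uv vL.
have [s + su] := len_attained u0 (le_trans uv vL).
have [t + tv] := len_attained (le_trans u0 uv) vL.
rewrite !in_itv/= => /andP[lt th] /andP[ls sh].
rewrite -su -tv !arc_param_len//.
case: (leP s t) => st; first exact: mdist_le_len.
have := mdist_le_len lt (ltW st) sh.
have := len_mono lt (ltW st) sh.
by rewrite (metric_sym (c s)); lra.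
Qed.

Lemma arc_param_in D u : curve_in D c -> 0 <= u -> u <= len (hi c) ->
  D (arc_param c u).
Proof.
move=> cD u0 uL; have [t tI <-] := len_attained u0 uL.
by move: (tI); rewrite in_itv/= => /andP[? ?]; rewrite arc_param_len//; exact: cD.
Qed.

End RectifiableCurve.

Section Subcurve.
Context {R : realType} {X : pmetricType R}.
Variables (c : curve X) (s t : R).
Hypotheses (rect : rectifiable c) (ls : lo c <= s) (st : s <= t) (th : t <= hi c).

Lemma subcurve_continuous : {within `[s, t], continuous c}.
Proof.
apply: continuous_subspaceW (@cfun_continuous _ _ c).
by apply: subset_itv; rewrite bnd_simp.
Qed.

Definition subcurve : curve X := Curve st subcurve_continuous.

Lemma subcurve_in D : curve_in D c -> curve_in D subcurve.
Proof.
move=> cD x; rewrite in_itv => /andP[sx xt]; have {}sx : s <= x := sx; have {}xt : x <= t := xt.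
by apply: cD; rewrite in_itv; apply/andP; split; [exact: le_trans ls sx | exact: le_trans xt th].
Qed.

Lemma curve_length_subcurve : curve_length subcurve = (len c t - len c s)%:E.
Proof. by rewrite /curve_length/= arc_length_len. Qed.

Lemma subcurve_rectifiable : rectifiable subcurve.
Proof. by rewrite /rectifiable curve_length_subcurve ltry. Qed.

Lemma arc_param_subcurve u : 0 <= u -> u <= len c t - len c s ->
  arc_param subcurve u = arc_param c (len c s + u).
Proof.
move=> u0 uL.
have [] := len_attained subcurve_rectifiable u0.
  by rewrite -lee_fin -curve_length_len ?curve_length_subcurve//; exact: subcurve_rectifiable.
move=> x; rewrite in_itv => /andP[sx xt] xu; have {}sx : s <= x := sx; have {}xt : x <= t := xt.
rewrite -[in LHS]xu arc_param_len//=; last exact: subcurve_rectifiable.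
have lx := le_trans ls sx; have xh := le_trans xt th.
have <- : len c x = len c s + u.
  by rewrite -xu {3}/len /= (arc_length_len rect ls sx xh) /= addrC subrK.
by rewrite (arc_param_len rect).
Qed.

End Subcurve.
(** * Pasting integral bounds along the line *)

Section Patch.
Context {d} {T : measurableType d} {R : realType}.

Lemma measurable_fun_patch (A D : set T) (f g : T -> \bar R) :
  measurable A -> measurable_fun D f -> measurable_fun D g ->
  measurable_fun D (patch g A f).
Proof.
move=> mA mf mg mD Y mY.
rewrite (_ : _ `&` _ = (A `&` (D `&` f @^-1` Y)) `|` (~` A `&` (D `&` g @^-1` Y))).
  by apply: measurableU; apply: measurableI; [|exact: mf|exact: measurableC|exact: mg].
apply/seteqP; split=> x /=; rewrite /patch; case: ifPn => Ax.
- by move=> [Dx Yx]; left; split=> //; exact: set_mem.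
- by move=> [Dx Yx]; right; split=> // A0; rewrite mem_set in Ax.
- by move=> [[_ //]|[nA]]; case: nA; exact: set_mem.
- by move=> [[Ax']|[_ //]]; rewrite mem_set in Ax.
Qed.

Lemma patch_ge0 (A D : set T) (f g : T -> \bar R) :
  (forall x, D x -> 0 <= f x)%E -> (forall x, D x -> 0 <= g x)%E ->
  (forall x, D x -> 0 <= patch g A f x)%E.
Proof. by move=> f0 g0 x Dx; rewrite /patch; case: ifP => _; [exact: f0|exact: g0]. Qed.

End Patch.

Section IncrementBound.
Context {R : realType}.
Variables (L : R) (h : R -> R).
Local Notation I := (`[0, L]%classic : set R).
Local Notation leb := (@lebesgue_measure R).

(** Bounds on all subintervals are what allows splitting at a point, and the finite integral is what
    provides a dominating function for countable unions. *)
Definition increment_bound (g : R -> \bar R) :=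
  [/\ measurable_fun I g, forall x, I x -> (0 <= g x)%E,
    (\int[leb]_(x in I) g x < +oo)%E &
    forall s t, 0 <= s -> s <= t -> t <= L ->
      (`|h s - h t|%:E <= \int[leb]_(x in `[s, t]) g x)%E].

(* The sets along which any two bounds can be pasted form a sigma-algebra. *)
Definition pastes (A : set R) := measurable A /\
  forall g1 g2, increment_bound g1 -> increment_bound g2 ->
    increment_bound (patch g2 A g1).

Lemma patch_integral_lty (A : set R) g1 g2 : measurable A ->
  increment_bound g1 -> increment_bound g2 ->
  (\int[leb]_(x in I) patch g2 A g1 x < +oo)%E.
Proof.
move=> mA [m1 p1 f1 _] [m2 p2 f2 _].
apply: (@le_lt_trans _ _ (\int[leb]_(x in I) (g1 x + g2 x))%E); last first.
  by rewrite ge0_integralD// lte_add_pinfty.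
apply: ge0_le_integral => //.
- exact: patch_ge0.
- exact: measurable_fun_patch.
- exact: emeasurable_funD.
move=> x Ix; rewrite /patch; case: ifP => _; first by rewrite leeDl ?p2.
by rewrite leeDr ?p1.
Qed.

Lemma pastesC A : pastes A -> pastes (~` A).
Proof.
move=> [mA pA]; split; first exact: measurableC.
move=> g1 g2 b1 b2; rewrite (_ : patch g2 (~` A) g1 = patch g1 A g2).
  exact: pA.
by apply/funext => x; rewrite /patch in_setC if_neg.
Qed.

Lemma pastesU A B : pastes A -> pastes B -> pastes (A `|` B).
Proof.
move=> [mA pA] [mB pB]; split; first exact: measurableU.
move=> g1 g2 b1 b2.
rewrite (_ : patch g2 (A `|` B) g1 = patch (patch g2 B g1) A g1).
  by apply: (pA) => //; exact: pB.
by apply/funext => x; rewrite /patch in_setU; case: (x \in A).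
Qed.

(** An interval that contains [b] is split there; [g1] bounds the increment on the left, [g2] the
    one on the right, and the triangle inequality adds them. *)
Lemma pastes_ray b : pastes `]-oo, b].
Proof.
split; first exact: measurable_itv.
move=> g1 g2 b1 b2; split; [| |exact: patch_integral_lty|].
- by case: b1 b2 => m1 _ _ _ [m2 _ _ _]; exact: measurable_fun_patch.
- by case: b1 b2 => _ p1 _ _ [_ p2 _ _]; exact: patch_ge0.
have mP : measurable_fun I (patch g2 `]-oo, b] g1).
  by case: b1 b2 => m1 _ _ _ [m2 _ _ _]; exact: measurable_fun_patch.
have P0 x : I x -> (0 <= patch g2 `]-oo, b] g1 x)%E.
  by case: b1 b2 => _ p1 _ _ [_ p2 _ _]; exact: patch_ge0.
have low s t : t <= b -> (\int[leb]_(x in `[s, t]) patch g2 `]-oo, b] g1 x =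
    \int[leb]_(x in `[s, t]) g1 x)%E.
  move=> tb; apply: eq_integral => x /set_mem /=; rewrite in_itv/= => /andP[sx xt].
  by rewrite patchT// inE/= in_itv/=; lra.
have high s t : b <= s -> (\int[leb]_(x in `]s, t]) patch g2 `]-oo, b] g1 x =
    \int[leb]_(x in `]s, t]) g2 x)%E.
  move=> bs; apply: eq_integral => x /set_mem /=; rewrite in_itv/= => /andP[sx xt].
  rewrite /patch ifF//; apply/negP => /set_mem /=; rewrite in_itv/=; lra.
have sub s t : 0 <= s -> t <= L -> `[s, t] `<=` I.
  by move=> s0 tL; apply: subset_itv; rewrite bnd_simp.
move=> s t s0 st tL.
case: b1 => m1 p1 _ H1; case: b2 => m2 p2 _ H2.
have [tb|bt] := leP t b; first by rewrite low//; exact: H1.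
have hL x y f : measurable_fun I f -> 0 <= x -> y <= L ->
    (\int[leb]_(u in `]x, y]) f u = \int[leb]_(u in `[x, y]) f u)%E.
  move=> mf x0 yL; rewrite integral_itv_obnd_cbnd//.
  apply: measurable_funS mf => //.
  by apply: subset_itv; rewrite bnd_simp.
have [bs|sb] := ltP b s.
  by rewrite -hL// high ?(ltW bs)// hL//; exact: H2.
have -> : (`[s, t] = `[s, b] `|` `]b, t])%classic.
  by rewrite -itv_bndbnd_setU// bnd_simp// ltW.
rewrite ge0_integral_setU//.
- rewrite low// high// hL//; last lra.
  apply: le_trans (leeD (H1 s b s0 sb _) (H2 b t _ (ltW bt) tL)); [|lra|lra].
  by rewrite -EFinD lee_fin (le_trans _ (ler_normD _ _))// addrA subrK.
- rewrite -itv_bndbnd_setU ?bnd_simp// ?(ltW bt)//.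
  by apply: measurable_funS mP => //; exact: sub.
- move=> x; rewrite -itv_bndbnd_setU ?bnd_simp// ?(ltW bt)// => xst.
  by apply: P0; exact: sub xst.
- apply/disj_setPLR => x /=; rewrite !in_itv/= => /andP[_ xb]; apply/negP; lra.
Qed.

(** The patches along the finite unions converge pointwise, being eventually constant at each point,
    and are dominated by [g1 + g2]; so the bounds survive in the limit. *)
Lemma pastes_bigcup (F : (set R)^nat) :
  (forall n, pastes (F n)) -> pastes (\bigcup_n F n).
Proof.
move=> pF.
have mU : measurable (\bigcup_n F n).
  by apply: bigcup_measurable => n _; case: (pF n).
split=> // g1 g2 b1 b2.
pose G n := \big[setU/set0]_(i < n) F i.
have pG n : pastes (G n).
  rewrite /G; elim: n => [|n IH]; last by rewrite big_ord_recr; exact: pastesU.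
  rewrite big_ord0; split=> // f1 f2 _.
  by rewrite (_ : patch f2 set0 f1 = f2)//; apply/funext => x; rewrite /patch in_set0.
have bG n := (pG n).2 g1 g2 b1 b2.
have fin := patch_integral_lty mU b1 b2.
have [m1 p1 f1 _] := b1; have [m2 p2 f2 _] := b2.
split=> //; [exact: measurable_fun_patch|exact: patch_ge0|].
move=> s t s0 st tL.
have sub : `[s, t] `<=` I by apply: subset_itv; rewrite bnd_simp.
have := @dominated_convergence _ _ _ leb `[s, t] _ (fun n => patch g2 (G n) g1)
  (patch g2 (\bigcup_n F n) g1) (g1 \+ g2)%E.
case.
- exact: measurable_itv.
- by move=> n; apply: measurable_funS sub _ => //; case: (bG n).
- by apply: measurable_funS sub _ => //; exact: measurable_fun_patch.
- apply: aeW => x xst; apply: cvg_near_cst.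
  case: (pselect ((\bigcup_n F n) x)) => [[k _ Fk]|nF].
    exists k.+1 => // n /= kn; rewrite !patchT//; apply/mem_set; first by exists k.
    by rewrite /G -bigcup_mkord; exists k.
  exists 0%N => // n _; rewrite /patch !ifF//; apply/negP => /set_mem.
    by [].
  by rewrite /G -bigcup_mkord => -[k _ Fk]; apply: nF; exists k.
- apply/integrableP; split.
    by apply: measurable_funS sub _ => //; exact: emeasurable_funD.
  apply: (@le_lt_trans _ _ (\int[leb]_(x in I) (g1 x + g2 x))%E); last first.
    by rewrite ge0_integralD// lte_add_pinfty.
  under eq_integral => x xst.
    rewrite gee0_abs; last by have := sub _ (set_mem xst); move=> Ix; rewrite adde_ge0 ?p1 ?p2.
    over.
  apply: ge0_subset_integral => //; first exact: emeasurable_funD.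
  by move=> x Ix; rewrite adde_ge0 ?p1 ?p2.
- apply: aeW => x n /sub Ix; rewrite gee0_abs; last exact: patch_ge0 Ix.
  by rewrite /patch; case: ifP => _; rewrite (leeDl, leeDr) ?p1 ?p2.
move=> _ _; apply: cvge_ge; apply: nearW => n.
by case: (bG n) => _ _ _; exact.
Qed.

Lemma pastes_measurable A : measurable A -> pastes A.
Proof.
apply: smallest_sub => [|_ [[a b] _ <-]]; last first.
  rewrite (_ : `]a, b]%classic = ~` (~` `]-oo, b] `|` `]-oo, a])).
    by apply/pastesC/pastesU; [apply: pastesC|]; exact: pastes_ray.
  rewrite setCU setCK setCitvl; apply/seteqP; split=> x /=; rewrite !in_itv/= ?andbT.
    by move=> /andP[].
  by move=> [-> ->].
split.
- split=> // f1 f2 _.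
  by rewrite (_ : patch f2 set0 f1 = f2)//; apply/funext => x; rewrite /patch in_set0.
- by move=> B pB; rewrite setTD; exact: pastesC.
- exact: pastes_bigcup.
Qed.

(** The minimum is the patch along the set where [g1 < g2]. This set is merely measurable, which is
    why pasting along intervals is not enough. *)
Lemma increment_bound_min g1 g2 : increment_bound g1 -> increment_bound g2 ->
  increment_bound (fun x => mine (g1 x) (g2 x)).
Proof.
move=> b1 b2; have [m1 p1 _ _] := b1; have [m2 p2 _ _] := b2.
have mA : measurable (I `&` [set x | (g1 x < g2 x)%E]).
  exact: emeasurable_fun_lt.
have [mP P0 Pfin Pb] := (pastes_measurable mA).2 _ _ b1 b2.
have eqP x : I x ->
    patch g2 (I `&` [set x | (g1 x < g2 x)%E]) g1 x = mine (g1 x) (g2 x).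
  move=> Ix; rewrite /patch /mine; case: ltP => g12; first by rewrite ifT// inE.
  by rewrite ifF//; apply/negP => /set_mem /= [_]; rewrite ltNge g12.
split.
- by apply: eq_measurable_fun mP => x /set_mem; exact: eqP.
- by move=> x Ix; rewrite -eqP// P0.
- by under eq_integral => x xI do rewrite -(eqP _ (set_mem xI)).
move=> s t s0 st tL.
under eq_integral => x xst.
  rewrite -eqP; last by have := set_mem xst; apply: subset_itv; rewrite bnd_simp.
  over.
exact: Pb.
Qed.

End IncrementBound.

(** The image of Lebesgue measure under a translation has the right value on half-open intervals, so
    it is Lebesgue measure by uniqueness. *)
Lemma integral_shift {R : realType} (a l : R) (g : R -> \bar R) :
  measurable_fun (`[a, a + l] : set R) g ->
  (forall x, `[a, a + l]%classic x -> (0 <= g x)%E) ->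
  (\int[@lebesgue_measure R]_(x in `[0%R, l]) g (a + x)%R =
   \int[@lebesgue_measure R]_(x in `[a, (a + l)%R]) g x)%E.
Proof.
move=> mg g0.
pose phi (x : R) : R := a + x.
have mphi : measurable_fun [set: measurableTypeR R] (phi : _ -> measurableTypeR R).
  exact: measurable_funD.
have -> : `[0, l]%classic = phi @^-1` `[a, a + l].
  apply/seteqP; split=> x /=; rewrite /phi !in_itv/= => /andP[? ?]; lra.
rewrite -[LHS](@ge0_integral_pushforward _ _ (measurableTypeR R) (measurableTypeR R) R
  phi mphi lebesgue_measure _ g)//; last by move=> x /set_mem; exact: g0.
apply: eq_measure_integral => A mA _; apply/esym.
apply: (@lebesgue_measure_unique R
  (measure_function_pushforward__canonical__measure_function_Measure lebesgue_measure mphi)) => //.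
move=> _ [[x y] _ <-].
transitivity (lebesgue_measure (`](x - a), (y - a)] : set R)).
  rewrite !lebesgue_measure_itv/= !lte_fin ltrD2r.
  by case: ifP => // _; rewrite -!EFinB opprB addrA subrK.
congr (lebesgue_measure _).
apply/seteqP; split=> z /=; rewrite /phi !in_itv/= => /andP[? ?]; lra.
Qed.
(** * Integrals along curves *)

Lemma borel_open {T : topologicalType} (U : set T) : open U -> <<s open >> U.
Proof. exact: sub_gen_smallest. Qed.

Section CurveIntegral.
Context {R : realType} {X : pmetricType R}.
Local Notation leb := (@lebesgue_measure R).
Implicit Types (c : curve X) (D : set X) (g : X -> \bar R).

Lemma arc_param_dist c u v : rectifiable c ->
  u \in `[0, len c (hi c)] -> v \in `[0, len c (hi c)] ->
  mdist (arc_param c u) (arc_param c v) <= `|u - v|.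
Proof.
move=> rc; rewrite !in_itv/= => /andP[u0 uL] /andP[v0 vL].
have [uv|vu] := leP u v.
  by rewrite distrC ger0_norm ?subr_ge0// arc_param_lipschitz.
by rewrite metric_sym gtr0_norm ?subr_gt0// arc_param_lipschitz// ltW.
Qed.

Lemma measurable_arc_param c (B : set X) : rectifiable c -> <<s open >> B ->
  measurable (`[0, len c (hi c)] `&` arc_param c @^-1` B).
Proof.
move=> rc; set I := `[0, _]%classic.
have mI : measurable I by exact: measurable_itv.
move: B; apply: smallest_sub; first split.
- by rewrite preimage_set0 setI0.
- move=> B /= mB; rewrite setTD preimage_setC.
  rewrite (_ : I `&` _ = I `\` (I `&` arc_param c @^-1` B)).
    exact: measurableD.
  by rewrite setDIr setDv set0U setDE.
- move=> F mF /=; rewrite preimage_bigcup setI_bigcupr.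
  by apply: bigcup_measurable => n _; exact: mF.
move=> U oU /=.
(* The Lipschitz bound holds only inside [I], so the preimage is open only relative to [I]; [W]
   accepts all points outside. *)
pose W := [set v | I v -> U (arc_param c v)].
rewrite (_ : _ `&` _ = I `&` interior W).
  apply: measurableI => //; apply: open_measurable; exact: open_interior.
apply/seteqP; split=> u [Iu]; last by move/interior_subset => /(_ Iu).
move=> /= Uu; split=> //; rewrite /interior /=.
have : nbhs (arc_param c u) U by exact: open_nbhs_nbhs.
rewrite -nbhs_ballE => -[e /= e0 eU].
apply/nbhs_ballP; exists e => //= v; rewrite /ball/= => uv Iv.
apply: eU; rewrite ballEmdist/=; exact: le_lt_trans (arc_param_dist rc Iu Iv) uv.
Qed.

Lemma measurable_fun_arc_param c D g : rectifiable c -> curve_in D c ->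
  open D -> borel_fun D g ->
  measurable_fun `[0, len c (hi c)] (g \o arc_param c).
Proof.
move=> rc cD oD mg _ Y mY.
have mB : <<s open >> (D `&` g @^-1` Y) by apply: mg => //; exact: borel_open.
have := measurable_arc_param rc mB; congr measurable.
apply/seteqP; split=> u [Iu] /=; first by case.
move=> Yu; split=> //; split=> //.
by move: (Iu); rewrite /= in_itv/= => /andP[u0 uL]; exact: arc_param_in cD _ _.
Qed.

Lemma arc_param_ge0 c D g : rectifiable c -> curve_in D c ->
  (forall x, D x -> 0 <= g x)%E ->
  forall u, `[0, len c (hi c)]%classic u -> (0 <= (g \o arc_param c) u)%E.
Proof.
move=> rc cD g0 u; rewrite /= in_itv/= => /andP[u0 uL].
by apply: g0; exact: arc_param_in cD _ _.
Qed.

Lemma curve_integralE c g : rectifiable c -> curve_integral c g =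
  (\int[leb]_(u in `[0%R, len c (hi c)]) (g \o arc_param c) u)%E.
Proof. by move=> rc; rewrite /curve_integral curve_length_len. Qed.

Lemma curve_integral_subcurve c D g s t (rc : rectifiable c)
    (ls : lo c <= s) (st : s <= t) (th : t <= hi c) :
  curve_in D c -> open D -> borel_fun D g -> (forall x, D x -> 0 <= g x)%E ->
  curve_integral (subcurve ls st th) g =
  (\int[leb]_(u in `[len c s, len c t]) (g \o arc_param c) u)%E.
Proof.
move=> cD oD mg g0; rewrite /curve_integral (curve_length_subcurve rc)/=.
have sub : `[len c s, len c t] `<=` `[0, len c (hi c)].
  apply: subset_itv; rewrite bnd_simp; first by apply: len_ge0 => //; lra.
  by apply: len_mono => //; lra.
have tE : len c t = len c s + (len c t - len c s) by rewrite addrC subrK.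
transitivity (\int[leb]_(u in `[0%R, (len c t - len c s)%R])
    (g \o arc_param c) (len c s + u)%R)%E.
  apply: eq_integral => u /set_mem uI; congr g.
  by move: uI; rewrite /= in_itv/= => /andP[u0 uL]; exact: arc_param_subcurve.
rewrite (@integral_shift _ _ _ (g \o arc_param c)) -?tE//.
  by apply: measurable_funS sub _ => //; exact: measurable_fun_arc_param mg.
by move=> u /sub; exact: (arc_param_ge0 rc cD g0).
Qed.

Lemma le_curve_integral c D g1 g2 : rectifiable c -> curve_in D c -> open D ->
  borel_fun D g1 -> borel_fun D g2 -> (forall x, D x -> 0 <= g1 x)%E ->
  (forall x, D x -> g1 x <= g2 x)%E ->
  (curve_integral c g1 <= curve_integral c g2)%E.
Proof.
move=> rc cD oD m1 m2 g0 g12; rewrite !curve_integralE//.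
apply: ge0_le_integral => //; [exact: arc_param_ge0 cD g0 | | |].
- exact: measurable_fun_arc_param m1.
- exact: measurable_fun_arc_param m2.
move=> u; rewrite /= in_itv/= => /andP[u0 uL].
by apply: g12; exact: arc_param_in cD _ _.
Qed.

Lemma curve_integralZl c D g (k : R) : rectifiable c -> curve_in D c ->
  open D -> borel_fun D g -> (forall x, D x -> 0 <= g x)%E -> 0 <= k ->
  (curve_integral c (fun x => k%:E * g x) = k%:E * curve_integral c g)%E.
Proof.
move=> rc cD oD mg g0 k0; rewrite !curve_integralE//.
rewrite -ge0_integralZl_EFin//; first exact: arc_param_ge0 cD g0.
exact: measurable_fun_arc_param mg.
Qed.

Lemma curve_increment_bound c D (f : X -> R) g :
  forall (rc : rectifiable c), curve_in D c -> open D -> borel_fun D g ->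
  (forall x, D x -> 0 <= g x)%E -> (curve_integral c g < +oo)%E ->
  (forall (s t : R) (ls : lo c <= s) (st : s <= t) (th : t <= hi c),
    (`|f (c s) - f (c t)|%:E <= curve_integral (subcurve ls st th) g)%E) ->
  increment_bound (len c (hi c)) (f \o arc_param c) (g \o arc_param c).
Proof.
move=> rc cD oD mg g0 gfin H; split.
- exact: measurable_fun_arc_param mg.
- exact: arc_param_ge0 cD g0.
- by rewrite -curve_integralE.
move=> u v u0 uv vL.
have [s + su] := len_attained rc u0 (le_trans uv vL).
have [t + tv] := len_attained rc (le_trans u0 uv) vL.
rewrite !in_itv/= => /andP[lt th] /andP[ls sh].
(* The parameters [s] and [t] were found independently and may come in the wrong order; in that case
   monotonicity of [len] forces [u = v]. *)
have [st|ts] := leP s t.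
  rewrite /= -su -tv !arc_param_len//.
  by rewrite -(curve_integral_subcurve rc ls st th cD)//; exact: H.
have uvE : u = v.
  by apply/eqP; rewrite eq_le uv -su -tv len_mono// ltW.
rewrite uvE subrr normr0; apply: integral_ge0 => x /=; rewrite in_itv/= => /andP[? ?].
by apply: (arc_param_ge0 rc cD g0); rewrite /= in_itv/=; apply/andP; split; lra.
Qed.

Lemma curve_min_bound c D (f : X -> R) g1 g2 :
  rectifiable c -> curve_in D c -> open D ->
  increment_bound (len c (hi c)) (f \o arc_param c) (g1 \o arc_param c) ->
  increment_bound (len c (hi c)) (f \o arc_param c) (g2 \o arc_param c) ->
  (`|f (c (lo c)) - f (c (hi c))|%:E <=
   curve_integral c (fun x => mine (g1 x) (g2 x)))%E.
Proof.
move=> rc cD oD b1 b2; have lh := lo_le_hi c.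
have [_ _ _] := increment_bound_min b1 b2.
move=> /(_ 0 (len c (hi c)) (lexx _) (len_ge0 rc lh (lexx _)) (lexx _)).
by rewrite /= -{1}(len_lo rc) !arc_param_len// curve_integralE.
Qed.

End CurveIntegral.
(** * Exceptional families of curves *)

Lemma le_poweR {R : realType} (p : R) (x y : \bar R) : 0 < p ->
  (0 <= x -> x <= y -> x `^ p <= y `^ p)%E.
Proof.
move=> p0 x0 xy; apply: gt0_ler_poweR => //; first exact: ltW.
  by rewrite in_itv/= x0 leey.
by rewrite in_itv/= (le_trans x0 xy) leey.
Qed.

Lemma poweRK {R : realType} (p : R) (x : \bar R) : p != 0 ->
  (0 <= x)%E -> ((x `^ p) `^ p^-1)%E = x.
Proof. by move=> p0 x0; rewrite -poweRrM mulfV// poweRe1. Qed.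

Lemma poweRVK {R : realType} (p : R) (x : \bar R) : p != 0 ->
  (0 <= x)%E -> ((x `^ p^-1) `^ p)%E = x.
Proof. by move=> p0 x0; rewrite -poweRrM mulVf// poweRe1. Qed.

Section Weights.
Context {R : realType} {X : pmetricType R}.
Variables (mu : {outer_measure set X -> \bar R}) (p : R).
Hypotheses (breg : borel_regular mu) (p1 : 1 < p).
Implicit Types (D : set X) (g rho : X -> \bar R) (f : X -> R).

Local Notation car := (caratheodory_type mu).

Let p0 : 0 < p. Proof. exact: lt_trans p1. Qed.
Let pn0 : p != 0. Proof. by rewrite gt_eqF. Qed.

Lemma open_measurable_car D : open D -> measurable (D : set car).
Proof. by move=> oD; apply: breg.1; exact: borel_open. Qed.

Lemma borel_fun_measurable D g : open D -> borel_fun D g ->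
  measurable_fun (D : set car) (g : car -> \bar R).
Proof.
by move=> oD mg _ Y mY; apply: breg.1; apply: mg => //; exact: borel_open.
Qed.

Definition energy D g : \bar R := (\int[cmeasure mu]_(x in D) (g x `^ p))%E.

Lemma energy_ge0 D g : (0 <= energy D g)%E.
Proof. by apply: integral_ge0 => x _; exact: poweR_ge0. Qed.

Lemma measurable_poweR_fun d (T : measurableType d) (D : set T) (g : T -> \bar R) (s : R) :
  measurable_fun D g -> measurable_fun D (fun x => g x `^ s)%E.
Proof. by move=> mg; exact: (measurableT_comp (measurable_poweR s)). Qed.

Lemma le_energy D g1 g2 : open D -> borel_fun D g1 -> borel_fun D g2 ->
  (forall x, D x -> 0 <= g1 x)%E -> (forall x, D x -> g1 x <= g2 x)%E ->
  (energy D g1 <= energy D g2)%E.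
Proof.
move=> oD m1 m2 g0 g12; apply: ge0_le_integral.
- exact: open_measurable_car.
- by move=> x _; exact: poweR_ge0.
- by apply: measurable_poweR_fun; exact: borel_fun_measurable.
- by apply: measurable_poweR_fun; exact: borel_fun_measurable.
by move=> x Dx; apply: le_poweR => //; [exact: g0|exact: g12].
Qed.

Lemma energyZ D g (k : R) : open D -> borel_fun D g ->
  (forall x, D x -> 0 <= g x)%E -> 0 <= k ->
  energy D (fun x => k%:E * g x)%E = ((k `^ p)%:E * energy D g)%E.
Proof.
move=> oD mg g0 k0; rewrite /energy -ge0_integralZl_EFin ?powR_ge0//.
- by apply: eq_integral => x /set_mem Dx; rewrite poweRM ?g0// poweR_EFin.
- exact: open_measurable_car.
- by move=> x _; exact: poweR_ge0.
- by apply: measurable_poweR_fun; exact: borel_fun_measurable.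
Qed.

Definition Lp_weight D rho :=
  [/\ borel_fun D rho, forall x, D x -> (0 <= rho x)%E & (energy D rho < +oo)%E].

Lemma borel_funZ D g (k : R) : borel_fun D g -> borel_fun D (fun x => k%:E * g x)%E.
Proof.
move=> mg; apply: emeasurable_funM => //; exact: measurable_cst.
Qed.

(** The pointwise $\ell^p$ norm of the sequence dominates each term, and its energy is exactly the
    sum of the energies. *)
Lemma Lp_weight_dominating D (r : nat -> X -> \bar R) : open D ->
  (forall n, borel_fun D (r n)) -> (forall n x, D x -> 0 <= r n x)%E ->
  (\sum_(n <oo) energy D (r n) < +oo)%E ->
  exists2 rho, Lp_weight D rho & forall n x, D x -> (r n x <= rho x)%E.
Proof.
move=> oD mr r0 fin.
have s0 x : (0 <= \sum_(n <oo) r n x `^ p)%E.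
  by apply: nneseries_ge0 => n _ _; exact: poweR_ge0.
exists (fun x => (\sum_(n <oo) r n x `^ p) `^ p^-1)%E; last first.
  move=> n x Dx; rewrite -[leLHS](poweRK pn0 (r0 n x Dx)).
  apply: le_poweR; rewrite ?invr_gt0 ?poweR_ge0//.
  apply: le_trans (nneseries_lim_ge n.+1 _) => [|k _ _]; last exact: poweR_ge0.
  by rewrite big_nat_recr//= leeDr// sume_ge0// => k _; exact: poweR_ge0.
split.
- apply: measurable_poweR_fun; apply: (ge0_emeasurable_sum (P := xpredT)) => [k x _ _|k _].
    exact: poweR_ge0.
  by apply: measurable_poweR_fun; exact: mr.
- by move=> x _; exact: poweR_ge0.
apply: le_lt_trans fin; rewrite /energy -integral_nneseries//.
- by rewrite le_eqVlt; apply/predU1l; apply: eq_integral => x _; exact: poweRVK.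
- exact: open_measurable_car.
- by move=> n; apply: measurable_poweR_fun; exact: borel_fun_measurable.
- by move=> n x _; exact: poweR_ge0.
Qed.

(** Whether a curve integral is finite does not depend on positive factors, so each [r n] may be
    scaled until the energies are summable. *)
Lemma Lp_weight_finite D (r : nat -> X -> \bar R) : open D ->
  (forall n, Lp_weight D (r n)) ->
  exists2 rho, Lp_weight D rho & forall c, curve_in D c -> rectifiable c ->
    (curve_integral c rho < +oo -> forall n, curve_integral c (r n) < +oo)%E.
Proof.
move=> oD wr.
pose e n := fine (energy D (r n)).
have e0 n : 0 <= e n by apply: fine_ge0; exact: energy_ge0.
have eE n : energy D (r n) = (e n)%:E.
  by rewrite fineK// ge0_fin_numE ?energy_ge0//; case: (wr n).
(* Chosen so that [k n] times [r n] has energy at most $2^{-(n+1)}$; the summand 1 avoids a division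
   by zero. *)
pose k n := (1 / (2 ^ n.+1)%:R / (1 + e n)) `^ p^-1.
have b0 n : 0 < 1 / (2 ^ n.+1)%:R / (1 + e n).
  by rewrite !divr_gt0// ?ltr0n ?expn_gt0// ltr_pwDl.
have k0 n : 0 < k n by rewrite powR_gt0.
have kE n : k n `^ p = 1 / (2 ^ n.+1)%:R / (1 + e n).
  by rewrite -powRrM mulVf// powRr1// ltW.
have [||| rho wrho H] := @Lp_weight_dominating D (fun n x => (k n)%:E * r n x)%E oD.
- by move=> n; apply: borel_funZ; case: (wr n).
- move=> n x Dx; apply: mule_ge0; first by rewrite lee_fin ltW.
  by case: (wr n) => _ + _; apply.
- apply: le_lt_trans (ltry 1); apply: le_trans (@epsilon_trick0 R 1 xpredT ler01).
  apply: lee_nneseries => [n _ _|n _]; first exact: energy_ge0.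
  case: (wr n) => m g0 _; rewrite (energyZ oD m g0 (ltW (k0 n))) kE eE -EFinM lee_fin.
  rewrite -[leLHS]mulrA ler_piMr ?ltW// ?divr_gt0// ?ltr0n ?expn_gt0//.
  by rewrite mulrC ltr_pdivrMr ?mul1r ?ltrDr// ltr_pwDl.
exists rho => // c cD rc fin n.
case: (wr n) => m g0 _; case: wrho => mrho rho0 _.
have : ((k n)%:E * curve_integral c (r n) < +oo)%E.
  rewrite -(curve_integralZl rc cD oD m g0 (ltW (k0 n))).
  apply: le_lt_trans fin; apply: le_curve_integral (H n) => //.
    exact: borel_funZ.
  by move=> x Dx; rewrite mule_ge0 ?g0// lee_fin ltW.
case: (curve_integral c (r n)) => [x _|/=|_]; [exact: ltry| |by []].
by rewrite gt0_muley ?lte_fin.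
Qed.

(** The form in which weak upper gradients are used: the exceptional curves are those along which
    [rho] has infinite integral. The next two lemmas show the equivalence with modulus zero. *)
Definition bounds_increments D f g rho := forall c,
  curve_in D c -> rectifiable c -> (curve_integral c rho < +oo)%E ->
  (`|f (c (lo c)) - f (c (hi c))|%:E <= curve_integral c g)%E.

Lemma weak_upper_gradient_weight D f g : open D ->
  weak_upper_gradient mu p D f g ->
  exists2 rho, Lp_weight D rho & bounds_increments D f g rho.
Proof.
move=> oD [mg g0 [G [GD G0 bG]]].
(* With this bound on the energy of an admissible [r n], the multiples [(n+1) * r n] still have
   summable energies, while their integrals along a curve of [G] are at least [n+1]. A weight above
   all of them has infinite integral there. *)
pose e n : R := 1 / (2 ^ n.+1)%:R / n.+1%:R `^ p.
have e0 n : 0 < e n by rewrite !divr_gt0// ?ltr0n ?expn_gt0// powR_gt0.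
have /choice[r Hr] n : exists r, admissible D G r /\ (energy D r < (e n)%:E)%E.
  have /ereal_inf_lt[_ [r ar <-] re] : (modulus mu p D G < (e n)%:E)%E.
    by rewrite G0 lte_fin.
  by exists r.
have mr n : borel_fun D (r n) by case: (Hr n) => -[].
have r0 n x : D x -> (0 <= r n x)%E by case: (Hr n) => -[_ + _] _; apply.
have [||| rho wrho H] := @Lp_weight_dominating D (fun n x => (n.+1%:R)%:E * r n x)%E oD.
- by move=> n; exact: borel_funZ.
- by move=> n x Dx; rewrite mule_ge0 ?r0.
- apply: le_lt_trans (ltry 1); apply: le_trans (@epsilon_trick0 R 1 xpredT ler01).
  apply: lee_nneseries => [n _ _|n _]; first exact: energy_ge0.
  rewrite (energyZ oD (mr n) (r0 n))//.
  apply: le_trans (lee_wpmul2l _ (ltW (Hr n).2)) _; first by rewrite lee_fin powR_ge0.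
  by rewrite -EFinM lee_fin /e mulrC divfK// gt_eqF ?powR_gt0.
exists rho => // c cD rc fin; apply: bG => // Gc.
case: wrho => mrho rho0 _.
suff : (curve_integral c rho = +oo)%E by move=> H'; rewrite H' in fin.
apply/eqyP => A A0; pose n := Num.truncn A.
apply: (@le_trans _ _ (n.+1%:R)%:E); first by rewrite lee_fin ltW// truncnS_gt.
apply: (@le_trans _ _ ((n.+1%:R)%:E * curve_integral c (r n))%E).
  rewrite -[leLHS]mule1 lee_wpmul2l//.
  by case: (Hr n) => -[_ _ /(_ c Gc rc)].
rewrite -(curve_integralZl rc cD oD (mr n) (r0 n))//.
apply: le_curve_integral (H n) => //; first exact: borel_funZ.
by move=> x Dx; rewrite mule_ge0 ?r0.
Qed.

(** Every positive multiple of [rho] is admissible for the family of curves on which [rho] has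
    infinite integral, and small multiples have arbitrarily small energy; so that family has modulus
    zero. *)
Lemma weight_weak_upper_gradient D f g rho : open D ->
  borel_fun D g -> (forall x, D x -> 0 <= g x)%E ->
  Lp_weight D rho -> bounds_increments D f g rho -> weak_upper_gradient mu p D f g.
Proof.
move=> oD mg g0 [mrho rho0 finrho] H; split=> //.
exists [set c | [/\ curve_in D c, rectifiable c & curve_integral c rho = +oo%E]].
split; first by move=> c [].
- apply/eqP; rewrite eq_le; apply/andP; split; last first.
    by apply: le_ereal_inf_tmp => _ [r _ <-]; exact: energy_ge0.
  apply/lee_addgt0Pr => e e0; rewrite add0e.
  (* Makes the energy of [k * rho] at most [e], also when [rho] has energy 0. *)
  pose k := (e / (1 + fine (energy D rho))) `^ p^-1.
  have E0 : 0 <= fine (energy D rho) by rewrite fine_ge0// energy_ge0.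
  have b0 : 0 < e / (1 + fine (energy D rho)) by rewrite divr_gt0// ltr_pwDl.
  have k0 : 0 < k by rewrite powR_gt0.
  apply: (@le_trans _ _ (energy D (fun x => k%:E * rho x)%E)).
    apply: ereal_inf_lbound; exists (fun x => k%:E * rho x)%E => //; split.
    + exact: borel_funZ.
    + by move=> x Dx; rewrite mule_ge0 ?rho0// lee_fin ltW.
    + move=> c [cD rc ci] _; rewrite (curve_integralZl rc cD oD mrho rho0 (ltW k0)).
      by rewrite ci gt0_muley ?lte_fin// leey.
  rewrite (energyZ oD mrho rho0 (ltW k0)) -powRrM mulVf// (powRr1 (ltW b0)).
  rewrite -[energy D rho]fineK ?ge0_fin_numE ?energy_ge0// -EFinM lee_fin.
  rewrite -[leLHS]mulrA ler_piMr ?(ltW e0)//.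
  by rewrite mulrC ler_pdivrMr ?mul1r ?lerDr// ltr_pwDl.
move=> c cD rc nG; apply: H => //; rewrite ltey; apply/eqP => ci.
by apply: nG; split.
Qed.

End Weights.
(** * Minimal weak upper gradients *)

(** The difference [f - g] is nonnegative almost everywhere with integral at most 0. As [f] is
    integrable, it is finite almost everywhere, which excludes the meaningless difference of two
    infinite values. *)
Lemma ae_eq_of_integral_le {d} {T : measurableType d} {R : realType}
    (m : {measure set T -> \bar R}) (D : set T) (f g : T -> \bar R) :
  measurable D -> measurable_fun D f -> measurable_fun D g ->
  (forall x, D x -> 0 <= g x)%E -> (forall x, D x -> g x <= f x)%E ->
  (\int[m]_(x in D) f x < +oo)%E ->
  (\int[m]_(x in D) f x <= \int[m]_(x in D) g x)%E ->
  {ae m, forall x, D x -> f x = g x}.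
Proof.
move=> mD mf mg g0 gf ffin fg.
have f0 x : D x -> (0 <= f x)%E by move=> Dx; exact: le_trans (g0 x Dx) (gf x Dx).
have intf : m.-integrable D f.
  apply/integrableP; split=> //.
  by under eq_integral => x /set_mem Dx do rewrite gee0_abs ?f0//.
have intg : m.-integrable D g.
  by apply: le_integrable intf => // x Dx; rewrite !gee0_abs ?f0 ?g0 ?gf.
have fin := integrable_fin_num mD intg.
have mfg : measurable_fun D (f \- g)%E by exact: emeasurable_funB.
have ffine := integrable_ae mD intf.
have sub0 x : D x -> f x \is a fin_num -> (0 <= f x - g x)%E.
  by move=> Dx fx; rewrite sube_ge0 ?gf// fx orbT.
have abs0 : (\int[m]_(x in D) `|(f \- g) x| = 0)%E.
  transitivity (\int[m]_(x in D) (f \- g) x)%E.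
    apply: ae_eq_integral => //; first exact: measurableT_comp.
    by apply: filterS ffine => x fx Dx; rewrite gee0_abs//= sub0// fx.
  apply: (etrans (integralB mD intf intg)); apply/eqP; rewrite eq_le.
  apply/andP; split; first by rewrite leeBlDr ?add0e.
  by rewrite sube_ge0 ?fin ?orbT//; exact: ge0_le_integral.
have /(ae_eq_integral_abs m mD mfg) := abs0.
apply: filterS2 ffine => x fx fgx Dx.
have := fx Dx; have := fgx Dx; have := gf x Dx => /=.
by move: (f x) (g x) => [a| |] [b| |] //= _ [/eqP]; rewrite subr_eq0 => /eqP ->.
Qed.

Section MinimalGradient.
Context {R : realType} {X : pmetricType R}.
Variables (mu : {outer_measure set X -> \bar R}) (p : R).
Hypotheses (breg : borel_regular mu) (p1 : 1 < p).
Implicit Types (D : set X) (g : X -> \bar R) (f : X -> R).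

Local Notation car := (caratheodory_type mu).
Local Notation energy := (energy mu p).
Local Notation wug := (weak_upper_gradient mu p).

Let p0 : 0 < p. Proof. exact: lt_trans p1. Qed.
Let pn0 : p != 0. Proof. by rewrite gt_eqF. Qed.

Lemma curve_integral_subcurve_le D g c s t (rc : rectifiable c)
    (ls : lo c <= s) (st : s <= t) (th : t <= hi c) :
  curve_in D c -> open D -> borel_fun D g -> (forall x, D x -> 0 <= g x)%E ->
  (curve_integral (subcurve ls st th) g <= curve_integral c g)%E.
Proof.
move=> cD oD mg g0.
rewrite (curve_integral_subcurve rc ls st th cD oD mg g0) curve_integralE//.
apply: ge0_subset_integral => //; first exact: measurable_fun_arc_param mg.
  exact: (arc_param_ge0 rc cD g0).
apply: subset_itv; rewrite bnd_simp; first by apply: len_ge0 => //; lra.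
by apply: len_mono => //; lra.
Qed.

Lemma bounds_increments_curve D f g rho c : open D -> borel_fun D g ->
  (forall x, D x -> 0 <= g x)%E -> Lp_weight mu p D rho ->
  bounds_increments D f g rho -> curve_in D c -> rectifiable c ->
  (curve_integral c rho < +oo)%E -> (curve_integral c g < +oo)%E ->
  increment_bound (len c (hi c)) (f \o arc_param c) (g \o arc_param c).
Proof.
move=> oD mg g0 [mr r0 _] H cD rc rfin gfin.
apply: (curve_increment_bound rc cD oD mg g0 gfin) => s t ls st th.
apply: (H (subcurve ls st th)).
- exact: subcurve_in.
- exact: subcurve_rectifiable.
exact: le_lt_trans (curve_integral_subcurve_le rc ls st th cD oD mr r0) rfin.
Qed.

Lemma weak_upper_gradient_min D f g1 g2 : open D -> wug D f g1 -> wug D f g2 ->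
  (energy D g1 < +oo)%E -> (energy D g2 < +oo)%E ->
  wug D f (fun x => mine (g1 x) (g2 x)).
Proof.
move=> oD w1 w2 f1 f2.
have [r1 wr1 H1] := weak_upper_gradient_weight breg p1 oD w1.
have [r2 wr2 H2] := weak_upper_gradient_weight breg p1 oD w2.
have [m1 p1' _] := w1; have [m2 p2 _] := w2.
(* The sequence [r1], [r2], [g1], [g2], [g2], ...: a single weight then guarantees that both bounds
   hold on all subcurves and that both gradients have finite integral along the curve. *)
pose r n := nth g2 [:: r1; r2; g1] n.
have wr n : Lp_weight mu p D (r n).
  by case: n => [|[|[|n]]] //; rewrite /r /= ?nth_nil.
have [rho wrho fin] := Lp_weight_finite breg p1 oD wr.
apply: (weight_weak_upper_gradient breg p1 oD _ _ wrho).
- exact: measurable_mine.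
- by move=> x Dx; rewrite le_min p1'// p2.
move=> c cD rc /(fin c cD rc) rfin.
apply: (curve_min_bound rc cD oD).
  by apply: (bounds_increments_curve oD m1 p1' wr1 H1 cD rc (rfin 0%N) (rfin 2%N)).
exact: (bounds_increments_curve oD m2 p2 wr2 H2 cD rc (rfin 1%N) (rfin 3%N)).
Qed.

Lemma weak_upper_gradient_inf D f (g : nat -> X -> \bar R) : open D ->
  (forall n, wug D f (g n)) -> (energy D (g 0%N) < +oo)%E ->
  (forall x, nonincreasing_seq (g ^~ x)) ->
  wug D f (fun x => ereal_inf (range (g ^~ x))).
Proof.
move=> oD wg fin0 decr.
have mg n : borel_fun D (g n) by case: (wg n).
have g0 n x : D x -> (0 <= g n x)%E by case: (wg n) => _ + _; apply.
have inf0 x : D x -> (0 <= ereal_inf (range (g ^~ x)))%E.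
  by move=> Dx; apply: le_ereal_inf_tmp => _ [n _ <-]; exact: g0.
have cvg x : g ^~ x @ \oo --> ereal_inf (range (g ^~ x)).
  exact: ereal_nonincreasing_cvgn.
have minf : borel_fun D (fun x => ereal_inf (range (g ^~ x))).
  by apply: emeasurable_fun_cvg mg _ => x _; exact: cvg.
have /choice[r /all_and2[wr Hr]] n :
    exists r, Lp_weight mu p D r /\ bounds_increments D f (g n) r.
  by have [r ? ?] := weak_upper_gradient_weight breg p1 oD (wg n); exists r.
(* [g 0] is put in front of the weights so that it is integrable along the curve and can serve as
   the dominating function. *)
pose r' n := if n is m.+1 then r m else g 0%N.
have wr' n : Lp_weight mu p D (r' n).
  by case: n => [|n]; [split; [exact: mg|exact: (g0 0%N)|exact: fin0]|exact: wr].
have [rho wrho fin] := Lp_weight_finite breg p1 oD wr'.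
apply: (weight_weak_upper_gradient breg p1 oD minf inf0 wrho).
move=> c cD rc /(fin c cD rc) rfin.
rewrite (curve_integralE _ rc).
have := @dominated_convergence _ _ _ (@lebesgue_measure R) `[0, len c (hi c)] _
  (fun n => g n \o arc_param c)
  ((fun x => ereal_inf (range (g ^~ x))) \o arc_param c) (g 0%N \o arc_param c).
case.
- exact: measurable_itv.
- by move=> n; exact: measurable_fun_arc_param (mg n).
- exact: measurable_fun_arc_param minf.
- by apply: aeW => x _; exact: cvg.
- apply/integrableP; split; first exact: measurable_fun_arc_param (mg 0%N).
  under eq_integral => x /set_mem xI do
    rewrite gee0_abs ?(arc_param_ge0 rc cD (g0 0%N) xI)//.
  by have := rfin 0%N; rewrite /r' curve_integralE.
- apply: aeW => x n xI; rewrite gee0_abs ?(arc_param_ge0 rc cD (g0 n) xI)//.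
  exact: decr.
move=> _ _; apply: cvge_ge; apply: nearW => n.
by have := Hr n c cD rc (rfin n.+1); rewrite curve_integralE.
Qed.

Lemma normLpE D (s : R) (f : X -> \bar R) : s != 0 ->
  normLp mu D s f = ((\int[cmeasure mu]_(x in D) `|f x| `^ s) `^ s^-1)%E.
Proof.
move=> s0; rewrite /normLp unlock [in RHS]integral_mkcond; congr (_ `^ _)%E.
apply: eq_integral => x _; rewrite /patch.
by case: ifP => // _; rewrite abse0 poweR0r.
Qed.

Lemma normLp_energy D g : (forall x, D x -> 0 <= g x)%E ->
  normLp mu D p g = (energy D g `^ p^-1)%E.
Proof.
move=> g0; rewrite normLpE//; congr (_ `^ _)%E; apply: eq_integral => x /set_mem Dx.
by rewrite gee0_abs// g0.
Qed.

Lemma normLp_lty D g : (forall x, D x -> 0 <= g x)%E ->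
  (normLp mu D p g < +oo)%E <-> (energy D g < +oo)%E.
Proof.
move=> g0; rewrite normLp_energy//; split; last exact: poweR_lty.
by apply: lty_poweRy; rewrite invr_neq0.
Qed.

(** If passing to the minimum with [h] does not lower the energy of [g], then the p-th powers of [g]
    and of the minimum agree almost everywhere. *)
Lemma energy_mine_ae D g h : open D -> borel_fun D g -> borel_fun D h ->
  (forall x, D x -> 0 <= g x)%E -> (forall x, D x -> 0 <= h x)%E ->
  (energy D g < +oo)%E -> (energy D g <= energy D (fun x => mine (g x) (h x)))%E ->
  {ae cmeasure mu, forall x, D x -> (g x <= h x)%E}.
Proof.
move=> oD mg mh g0 h0 gfin gm.
have m0 x : D x -> (0 <= mine (g x) (h x))%E by move=> Dx; rewrite le_min g0// h0.
have := @ae_eq_of_integral_le _ car R (cmeasure mu) D (fun x => g x `^ p)%E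
  (fun x => mine (g x) (h x) `^ p)%E (open_measurable_car breg oD).
case=> //.
- by apply: measurable_poweR_fun; exact: borel_fun_measurable.
- apply: measurable_poweR_fun; apply: (borel_fun_measurable breg oD).
  exact: measurable_mine.
- by move=> x _; exact: poweR_ge0.
- by move=> x Dx; apply: le_poweR => //; [exact: m0|rewrite ge_min lexx].
move=> N [mN N0 sub]; exists N; split=> // x /= nle; apply: sub => /= eqx.
apply: nle => Dx; have := congr1 (poweR ^~ p^-1) (eqx Dx).
by rewrite /= !poweRK ?g0 ?m0// => ->; rewrite ge_min lexx orbT.
Qed.

Lemma exists_minimal_gradient D f g : open D -> wug D f g ->
  (normLp mu D p g < +oo)%E -> exists g', minimal_gradient mu p D f g'.
Proof.
move=> oD wg gfin.
have wge0 h x : wug D f h -> D x -> (0 <= h x)%E by move=> [_ + _]; apply.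
have {}gfin : (energy D g < +oo)%E by apply/normLp_lty => // x; exact: wge0.
pose W := [set h | wug D f h /\ (energy D h < +oo)%E].
pose E := ereal_inf [set energy D h | h in W].
have E0 : (0 <= E)%E by apply: le_ereal_inf_tmp => _ [h _ <-]; exact: energy_ge0.
have Efin : E \is a fin_num.
  rewrite ge0_fin_numE//; apply: (le_lt_trans _ gfin).
  by apply: ereal_inf_lbound; exists g => //; split.
have /choice[h Hh] (n : nat) : exists h, W h /\ (energy D h < E + (n.+1%:R^-1)%:E)%E.
  have /ereal_inf_lt[_ [h Wh <-] hE] : (E < E + (n.+1%:R^-1)%:E)%E.
    by rewrite lteDl// lte_fin.
  by exists h.
(* Running minima turn the minimizing sequence into a pointwise decreasing one, as
   [weak_upper_gradient_inf] demands, and stay below [h n]. *)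
pose fix m n := if n is k.+1 then fun x => mine (m k x) (h k.+1 x) else h 0%N.
have Wm n : W (m n).
  elim: n => [|n [wm mfin]] /=; first by case: (Hh 0%N).
  have [[wh hfin] _] := Hh n.+1.
  split; first exact: weak_upper_gradient_min.
  apply: le_lt_trans mfin; have [mm m0 _] := wm; have [mh h0 _] := wh.
  apply: (le_energy breg p1 oD) => //.
  - exact: measurable_mine.
  - by move=> x Dx; rewrite le_min m0// h0.
  - by move=> x Dx; rewrite ge_min lexx.
have decr x : nonincreasing_seq (m ^~ x).
  by apply/nonincreasing_seqP => n /=; rewrite ge_min lexx.
have mh n x : (m n x <= h n x)%E by case: n => [//|n] /=; rewrite ge_min lexx orbT.
pose g' x := ereal_inf (range (m ^~ x)).
have wg' : wug D f g'.
  by apply: weak_upper_gradient_inf => // [n|]; case: (Wm 0%N) => //; case: (Wm n).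
have [mg' g'0 _] := wg'.
have g'E : (energy D g' <= E)%E.
  apply/lee_addgt0Pr => e e0.
  pose n := Num.truncn e^-1.
  have ne : n.+1%:R^-1 <= e.
    by rewrite -[leRHS]invrK lef_pV2 ?posrE ?invr_gt0// ltW// truncnS_gt.
  have [[wh hfin] hE] := Hh n; have [mhn _ _] := wh.
  apply: (@le_trans _ _ (energy D (h n))).
    apply: (le_energy breg p1 oD) => // x Dx; apply: le_trans (mh n x).
    by apply: ereal_inf_lbound; exists n.
  by apply: le_trans (ltW hE) _; rewrite leeD2l// lee_fin.
have g'fin : (energy D g' < +oo)%E.
  by apply: le_lt_trans g'E _; rewrite ltey_eq Efin.
exists g'; split=> //; first exact/normLp_lty.
move=> k wk kfin; have [mk k0 _] := wk.
have {}kfin : (energy D k < +oo)%E by apply/normLp_lty.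
(* The minimum of [g'] and [k] is itself a competitor for [E], so its energy is not below that of
   [g']: least energy becomes pointwise minimality. *)
apply: energy_mine_ae => //; apply: le_trans g'E _; apply: ereal_inf_lbound.
exists (fun x => mine (g' x) (k x)) => //; split.
  exact: weak_upper_gradient_min.
apply: le_lt_trans g'fin; apply: (le_energy breg p1 oD) => //.
- exact: measurable_mine.
- by move=> x Dx; rewrite le_min g'0// k0.
- by move=> x Dx; rewrite ge_min lexx.
Qed.

Lemma le_normLp_ae D g1 g2 : open D -> borel_fun D g1 -> borel_fun D g2 ->
  (forall x, D x -> 0 <= g1 x)%E -> (forall x, D x -> 0 <= g2 x)%E ->
  {ae cmeasure mu, forall x, D x -> (g1 x <= g2 x)%E} ->
  (normLp mu D p g1 <= normLp mu D p g2)%E.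
Proof.
move=> oD m1 m2 g10 g20 g12; rewrite !normLp_energy//.
apply: le_poweR; rewrite ?invr_gt0 ?energy_ge0//.
apply: ae_ge0_le_integral.
- exact: open_measurable_car.
- by move=> x _; exact: poweR_ge0.
- by apply: measurable_poweR_fun; exact: borel_fun_measurable.
- by move=> x _; exact: poweR_ge0.
- by apply: measurable_poweR_fun; exact: borel_fun_measurable.
case: g12 => N [mN N0 sub]; exists N; split=> // x /= nle; apply: sub => /= le12.
by apply: nle => Dx; apply: le_poweR => //; [exact: g10|exact: le12].
Qed.

Lemma normLp_subset D D' g : open D -> open D' -> D `<=` D' -> borel_fun D' g ->
  (forall x, D' x -> 0 <= g x)%E -> (normLp mu D p g <= normLp mu D' p g)%E.
Proof.
move=> oD oD' sub mg g0; rewrite !normLp_energy// => [|x /sub]; last exact: g0.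
apply: le_poweR; rewrite ?invr_gt0 ?energy_ge0//.
apply: ge0_subset_integral => //; [exact: open_measurable_car..| |].
- by apply: measurable_poweR_fun; exact: borel_fun_measurable.
- by move=> x _; exact: poweR_ge0.
Qed.

End MinimalGradient.
(** * Seminorms under composition and restriction *)

Section MetricBalls.
Context {R : realType} {X : pmetricType R}.

Lemma open_mdist_ball (x : X) (r : R) : open (ball x r).
Proof.
rewrite openE => y; rewrite ballEmdist /= => xy.
rewrite /interior /=; apply/nbhs_ballP; exists (r - mdist x y); first by rewrite /= subr_gt0.
move=> z; rewrite !ballEmdist /= => yz.
by apply: le_lt_trans (metric_triangle x y z) _; lra.
Qed.

End MetricBalls.

Section Seminorm.
Context {R : realType} {X : pmetricType R}.
Variables (mu : {outer_measure set X -> \bar R}) (p : R).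
Hypotheses (breg : borel_regular mu) (p1 : 1 < p).
Implicit Types (D : set X) (g : X -> \bar R) (f u : X -> R).

Local Notation car := (caratheodory_type mu).
Local Notation wug := (weak_upper_gradient mu p).

Let p0 : 0 < p. Proof. exact: lt_trans p1. Qed.
Let pn0 : p != 0. Proof. by rewrite gt_eqF. Qed.

Lemma weak_upper_gradient_lipschitz D f u g :
  (forall x y, D x -> D y -> `|u x - u y| <= `|f x - f y|) -> wug D f g -> wug D u g.
Proof.
move=> uf [mg g0 [G [GD G0 bG]]]; split=> //; exists G; split=> // c cD rc nG.
apply: le_trans (bG c cD rc nG); rewrite lee_fin; apply: uf.
  by apply: cD; rewrite in_itv/= lexx lo_le_hi.
by apply: cD; rewrite in_itv/= lexx lo_le_hi.
Qed.

Lemma borel_fun_subset D D' g : D `<=` D' -> open D -> open D' ->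
  borel_fun D' g -> borel_fun D g.
Proof.
move=> sub oD oD'; apply: measurable_funS => //; exact: borel_open.
Qed.

(** A weight for [D'] restricts to one for [D], and curves in [D] are curves in [D']. *)
Lemma weak_upper_gradient_subset D D' f g : D `<=` D' -> open D -> open D' ->
  wug D' f g -> wug D f g.
Proof.
move=> sub oD oD' wg; have [mg g0 _] := wg.
have [rho [mrho rho0 fin] H] := weak_upper_gradient_weight breg p1 oD' wg.
apply: (weight_weak_upper_gradient breg p1 oD _ _ _ (rho := rho)).
- exact: borel_fun_subset mg.
- by move=> x /sub; exact: g0.
- split; first exact: borel_fun_subset mrho.
    by move=> x /sub; exact: rho0.
  apply: le_lt_trans fin; apply: ge0_subset_integral => //;
    [exact: open_measurable_car..| |].
  + by apply: measurable_poweR_fun; exact: borel_fun_measurable.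
  + by move=> x _; exact: poweR_ge0.
by move=> c cD; apply: H => t /cD /sub.
Qed.

Lemma normLp_ge0 D (s : R) g : (0 <= normLp mu D s g)%E.
Proof. exact: Lnorm_ge0. Qed.

Lemma mingradP D f : (exists g, minimal_gradient mu p D f g) ->
  minimal_gradient mu p D f (mingrad mu p D f).
Proof. by move=> ex; exact: (xgetPex (cst 0%E) ex). Qed.

Lemma S1p_seminorm_le D f g : open D -> wug D f g -> (normLp mu D p g < +oo)%E ->
  (S1p_seminorm mu p D f <= normLp mu D p g)%E.
Proof.
move=> oD wg gfin.
have [w fin least] := mingradP (exists_minimal_gradient breg p1 oD wg gfin).
case: (w) => mw w0 _; case: (wg) => mg g0 _.
by apply: le_normLp_ae => //; exact: least.
Qed.

Lemma S1p_seminorm_lipschitz D f u : open D -> S1p mu p D f ->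
  (forall x y, D x -> D y -> `|u x - u y| <= `|f x - f y|) ->
  (S1p_seminorm mu p D u <= S1p_seminorm mu p D f)%E.
Proof.
move=> oD [_ _ /mingradP[w fin _]] uf.
by apply: S1p_seminorm_le fin => //; exact: weak_upper_gradient_lipschitz w.
Qed.

Lemma S1p_seminorm_subset D D' f f' : open D -> open D' -> D `<=` D' ->
  S1p mu p D' f' -> (forall x, D x -> f' x = f x) ->
  (S1p_seminorm mu p D f <= S1p_seminorm mu p D' f')%E.
Proof.
move=> oD oD' sub [_ _ /mingradP[w fin _]] ff'; have [mw w0 _] := w.
have le := normLp_subset breg p1 oD oD' sub mw w0.
apply: (le_trans _ le); apply: S1p_seminorm_le => //; last exact: (le_lt_trans le fin).
apply: weak_upper_gradient_lipschitz (weak_upper_gradient_subset sub oD oD' w).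
by move=> x y Dx Dy; rewrite !ff'.
Qed.

Lemma N1p_S1p D u : balls_pos_fin mu -> open D -> N1p mu p D u -> S1p mu p D u.
Proof.
move=> balls oD [mu_u ufin [g wg gfin]]; split=> //; last first.
  exact: exists_minimal_gradient wg gfin.
have mD := open_measurable_car breg oD.
have {}ufin : (\int[cmeasure mu]_(x in D) (`|u x| `^ p)%:E < +oo)%E.
  move: ufin; rewrite normLpE// => /lty_poweRy; rewrite invr_neq0// => /(_ isT).
  by [].
move=> x Dx; exists 1 => //.
have mB : measurable (D `&` ball x 1 : set car).
  by apply: measurableI => //; apply: (open_measurable_car breg); exact: open_mdist_ball.
have mup : measurable_fun (D : set car) (fun y => (`|u y| `^ p)%:E).
  apply/measurable_EFinP; apply: (measurableT_comp (measurable_powR p)).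
  exact: measurableT_comp.
have mu_uB : measurable_fun (D `&` ball x 1 : set car) (EFin \o u).
  apply/measurable_EFinP; apply: measurable_funS mu_u => //; exact: subIsetl.
apply/integrableP; split=> //.
(* Local integrability from p-integrability: |u| is at most $1+|u|^p$, and balls have finite
   measure. *)
apply: (@le_lt_trans _ _
    (\int[cmeasure mu]_(y in D `&` ball x 1) (1 + (`|u y| `^ p)%:E))%E).
  apply: ge0_le_integral => //.
  - exact: measurableT_comp.
  - apply: emeasurable_funD; first exact: measurable_cst.
    by apply: measurable_funS mup => //; exact: subIsetl.
  move=> y _; rewrite /= lee_fin.
  have [u1|u1] := leP `|u y| 1; first by rewrite (le_trans u1)// lerDl powR_ge0.
  by rewrite (le_trans (le1r_powR _ (ltW p1)))// ?ltW// ltrDr.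
rewrite ge0_integralD//; last by apply: measurable_funS mup => //; exact: subIsetl.
rewrite integral_cst// mul1e lte_add_pinfty//.
  have /andP[_] := balls x 1 ltr01; apply: le_lt_trans.
  by apply: le_outer_measure; exact: subIsetr.
apply: le_lt_trans ufin; exact: ge0_subset_integral.
Qed.

End Seminorm.
(** * Existence of nonconstant Sobolev functions *)

Section AlmostEverywhere.
Context {R : realType} {X : pmetricType R}.
Variables (mu : {outer_measure set X -> \bar R}) (p : R).
Hypotheses (breg : borel_regular mu) (balls : balls_pos_fin mu) (p1 : 1 < p).

Local Notation car := (caratheodory_type mu).
Local Notation wug := (weak_upper_gradient mu p).

Lemma ae_in_ball (P : X -> Prop) (x : X) (r : R) : 0 < r ->
  {ae cmeasure mu, forall y, P y} -> exists2 y, ball x r y & P y.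
Proof.
move=> r0 [N [mN N0 sub]]; apply: contrapT => /forall2NP nP.
have /andP[+ _] := balls x r0; apply/negP; rewrite -leNgt.
rewrite -[leRHS]N0; apply: le_outer_measure => y xy; apply: sub => Py.
by have [] := nP y.
Qed.

Lemma measurable_ball_car (x : X) (r : R) : measurable (ball x r : set car).
Proof. by apply: (open_measurable_car breg); exact: open_mdist_ball. Qed.

Lemma bounded_integrable D (h : X -> R) (N : R) : measurable (D : set car) ->
  (mu D < +oo)%E -> mu_measurable_fun mu D h -> (forall x, D x -> `|h x| <= N) ->
  (cmeasure mu).-integrable D (EFin \o h).
Proof.
move=> mD Dfin mh hN; apply: measurable_bounded_integrable => //.
exists N; split; first exact: num_real.
by move=> M NM x Dx; exact: le_trans (hN x Dx) (ltW NM).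
Qed.

(** Zero energy annihilates the right side of the Poincare inequality, so [h] equals its mean on the
    ball. The bound [N] makes [h] integrable over the enlarged ball. *)
Lemma poincare_ae_constant (h : X -> R) (g : X -> \bar R) (x : X) (r N : R) :
  weak_poincare mu p -> mu_measurable_fun mu setT h -> (forall y, `|h y| <= N) ->
  wug setT h g -> energy mu p setT g = 0%E -> 0 < r ->
  exists k, {ae cmeasure mu, forall y, ball x r y -> h y = k}.
Proof.
move=> [s [C [s1 poin]]] mh hN wg eg r0.
have p0 : p != 0 by rewrite gt_eqF// (lt_trans ltr01).
have sr0 : 0 < s * r by rewrite mulr_gt0// (lt_trans ltr01).
have mhS (S : set X) : mu_measurable_fun mu S h by exact: measurable_funTS.
have /andP[B0 Bfin] := balls x r0.
have inth : (cmeasure mu).-integrable (ball x (s * r)) (EFin \o h).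
  apply: (bounded_integrable (N := N)) => //; first exact: measurable_ball_car.
  by have /andP[] := balls x sr0.
have wgB : wug (ball x (s * r)) h g.
  apply: (weak_upper_gradient_subset breg p1 (D' := setT)) => //.
    exact: open_mdist_ball.
  exact: openT.
have := poin x r h g r0 inth wgB.
have -> : (\int[cmeasure mu]_(y in ball x (s * r)) (g y `^ p) = 0)%E.
  apply/eqP; rewrite eq_le -{1}eg; apply/andP; split.
    apply: ge0_subset_integral => //; [exact: measurable_ball_car| |].
      by apply: measurable_poweR_fun; apply: (borel_fun_measurable breg openT); case: wg.
    by move=> y _; exact: poweR_ge0.
  by apply: integral_ge0 => y _; exact: poweR_ge0.
rewrite mul0e poweR0r ?invr_neq0// mule0.
set m := ball_mean mu x r h => le0; exists m.
have mBh : measurable_fun (ball x r : set car) (fun y => (h y - m)%:E).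
  by apply/measurable_EFinP; apply: measurable_funB => //; exact: mhS.
have : (\int[cmeasure mu]_(y in ball x r) `|(h y - m)%:E| = 0)%E.
  apply/eqP; rewrite eq_le; apply/andP; split; last exact: integral_ge0.
  by move: le0; rewrite pmule_lle0// inve_gt0 ?(gt_eqF B0) ?(lt_eqF Bfin).
move=> /(ae_eq_integral_abs _ (measurable_ball_car x r) mBh).
case=> M [mM M0 sub]; exists M; split=> // y /= nk; apply: sub => /= yk.
by apply: nk => /yk [/eqP]; rewrite subr_eq0 => /eqP.
Qed.

End AlmostEverywhere.

Section Truncation.
Context {R : realType}.
Implicit Types (N a b : R).

Definition truncate N a : R := Num.max (- N) (Num.min N a).

Lemma truncate_lipschitz N a b : `|truncate N a - truncate N b| <= `|a - b|.
Proof.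
have := ler_norm (b - a); rewrite distrC; have := ler_norm (a - b).
move: `|a - b| => d ? ?; rewrite ler_norml /truncate /Num.max /Num.min.
by case: (ltP N a) => ?; case: (ltP N b) => ?; do ![case: ltP => ?]; apply/andP; split; lra.
Qed.

Lemma truncate_norm N a : 0 <= N -> `|truncate N a| <= N.
Proof.
move=> N0; rewrite /truncate /Num.max /Num.min ler_norml.
by case: (ltP N a) => ?; case: ltP => ?; apply/andP; split; lra.
Qed.

Lemma truncate_id N a : `|a| <= N -> truncate N a = a.
Proof.
rewrite ler_norml => /andP[? ?]; rewrite /truncate /Num.max /Num.min.
by case: (ltP N a) => ?; case: ltP => ?; lra.
Qed.

Lemma truncate_norm_le N a : 0 <= N -> `|truncate N a| <= `|a|.
Proof.
move=> N0; have := truncate_lipschitz N a 0.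
by rewrite (truncate_id (a := 0)) ?normr0// !subr0.
Qed.

Lemma measurable_truncate d (T : measurableType d) (D : set T) (f : T -> R) N :
  measurable_fun D f -> measurable_fun D (fun x => truncate N (f x)).
Proof. by move=> mf; apply: measurable_maxr => //; exact: measurable_minr. Qed.

End Truncation.

Section Nondegenerate.
Context {R : realType} {X : pmetricType R}.
Variables (mu : {outer_measure set X -> \bar R}) (p : R).
Hypotheses (breg : borel_regular mu) (balls : balls_pos_fin mu) (p1 : 1 < p).

Local Notation car := (caratheodory_type mu).
Local Notation wug := (weak_upper_gradient mu p).

Let p0 : 0 < p. Proof. exact: lt_trans p1. Qed.
Let pn0 : p != 0. Proof. by rewrite gt_eqF. Qed.

Lemma mdist_lipschitz (x y z : X) : `|mdist x y - mdist x z| <= mdist y z.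
Proof.
have := metric_triangle x y z; have := metric_triangle x z y.
by rewrite ler_norml (metric_sym z y) => ? ?; apply/andP; split; lra.
Qed.

Lemma measurable_mdist (x : X) D : open D -> mu_measurable_fun mu D (mdist x).
Proof.
move=> oD; apply: measurable_funTS.
apply: (measurability _ (RGenInftyO.measurableE R)) => //.
move=> _ [_ [a ->] <-]; rewrite setTI.
rewrite (_ : _ @^-1` _ = ball x a); first exact: measurable_ball_car.
by apply/seteqP; split=> y; rewrite ballEmdist /= in_itv/=.
Qed.

Lemma energy0 D : energy mu p D (cst 0%E) = 0%E.
Proof. by rewrite /energy integral0_eq// => x _; rewrite poweR0r. Qed.

Lemma Lp_weight0 D : open D -> Lp_weight mu p D (cst 0%E).
Proof. by move=> oD; split; [exact: measurable_cst | by [] | rewrite energy0]. Qed.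

Lemma weak_upper_gradient_mdist D (x : X) : open D -> wug D (mdist x) (cst 1%E).
Proof.
move=> oD; apply: (weight_weak_upper_gradient breg p1 oD _ _ (Lp_weight0 oD)) => //.
  exact: measurable_cst.
move=> c cD rc _.
have -> : curve_integral c (cst 1%E) = curve_length c.
  rewrite curve_integralE// integral_cst// mul1e curve_length_len//.
  apply: (etrans (lebesgue_measure_itv `[0, len c (hi c)]%R)) => /=.
  rewrite lte_fin; case: ltP => [_|L0]; first by rewrite oppr0 adde0.
  by apply/esym/eqP; rewrite eqe eq_le L0 len_ge0// lo_le_hi.
apply: (le_trans _ (mdist_le_arc_length _ (lo_le_hi c))).
by rewrite lee_fin mdist_lipschitz.
Qed.

Lemma measure_bounded_lty D (x : X) (N : R) : 0 < N -> D `<=` ball x N ->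
  (mu D < +oo)%E.
Proof.
move=> N0 DN; have /andP[_] := balls x N0.
by apply: le_lt_trans; exact: le_outer_measure.
Qed.

Lemma bounded_normLp_lty D (f : X -> R) (s M : R) : 0 < s ->
  measurable (D : set car) -> (mu D < +oo)%E -> mu_measurable_fun mu D f ->
  (forall x, D x -> `|f x| <= M) -> (normLp mu D s (EFin \o f) < +oo)%E.
Proof.
move=> s0 mD Dfin mf fM; rewrite normLpE ?gt_eqF//; apply: poweR_lty.
apply: (@le_lt_trans _ _ (\int[cmeasure mu]_(x in D) (cst (M `^ s)%:E x))%E).
  apply: ge0_le_integral => //.
  - by move=> x _; exact: poweR_ge0.
  - apply: measurable_poweR_fun; apply: measurableT_comp => //.
    exact/measurable_EFinP.
  move=> x Dx; rewrite /= lee_fin; apply: ge0_ler_powR => //; first exact: ltW.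
    by rewrite nnegrE (le_trans _ (fM x Dx)).
  exact: fM.
by rewrite integral_cst// lte_mul_pinfty// lee_fin powR_ge0.
Qed.

Lemma N1p_mdist D (x : X) (N : R) : 0 < N -> open D -> D `<=` ball x N ->
  N1p mu p D (mdist x).
Proof.
move=> N0 oD DN; have mD := open_measurable_car breg oD.
have Dfin := measure_bounded_lty N0 DN.
split; first exact: measurable_mdist.
  apply: (bounded_normLp_lty (M := N)) => //; first exact: measurable_mdist.
  move=> y /DN; rewrite ballEmdist /= => /ltW.
  by rewrite ger0_norm// mdist_ge0.
exists (cst 1%E); first exact: weak_upper_gradient_mdist.
apply: (bounded_normLp_lty (f := cst 1) (M := 1)) => //; first exact: measurable_cst.
by move=> y _; rewrite normr1.
Qed.

(* The function is 0 at x and r elsewhere; along a curve, the distance to x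
   would have to take the value r / 2 in between. *)
Lemma weak_upper_gradient_isolated (x : X) (r : R) : 0 < r -> ball x r `<=` [set x] ->
  wug setT (fun y => truncate r (mdist x y)) (cst 0%E).
Proof.
move=> r0 iso; apply: (weight_weak_upper_gradient breg p1 openT _ _ (Lp_weight0 openT)) => //.
  exact: measurable_cst.
have far y : y <> x -> r <= mdist x y.
  by move=> yx; rewrite leNgt; apply/negP => xy; apply: yx; apply: iso; rewrite ballEmdist.
have val y : truncate r (mdist x y) = if y == x then 0 else r.
  case: eqP => [->|/far ry]; first by rewrite mdistxx truncate_id// normr0 ltW.
  rewrite /truncate (min_l ry) max_r//; lra.
move=> c _ rc _; rewrite [leRHS]curve_integralE// integral0//.
have cont : {within `[lo c, hi c], continuous (fun t => mdist x (c t))}.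
  apply/subspace_continuousP => t tI; apply/cvgrPdist_lt => e e0.
  have [d d0 H] := curve_continuous_at tI e0.
  rewrite near_withinE; exists d => //= s ts sI.
  by apply: le_lt_trans (mdist_lipschitz _ _ _) _; exact: H.
suff : (c (lo c) == x) = (c (hi c) == x).
  by rewrite !val => ->; rewrite subrr normr0.
have mid t : lo c <= t <= hi c -> mdist x (c t) <> r / 2.
  move=> _ tr; have [tx|/far] := pselect (c t = x); last lra.
  by move: tr; rewrite tx mdistxx; lra.
have ivt := IVT (v := r / 2) (lo_le_hi c) cont.
have [lx|/eqP lx] := eqVneq (c (lo c)) x; have [hx|/eqP hx] := eqVneq (c (hi c)) x => //.
- have [|t tI tr] := ivt.
    rewrite lx mdistxx; have := far _ hx => rh.
    by rewrite ge_min le_max; apply/andP; split; apply/orP; [left|right]; lra.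
  by case: (mid t _ tr); rewrite in_itv in tI.
- have [|t tI tr] := ivt.
    rewrite hx mdistxx; have := far _ lx => rh.
    by rewrite ge_min le_max; apply/andP; split; apply/orP; [right|left]; lra.
  by case: (mid t _ tr); rewrite in_itv in tI.
Qed.

(** In a one-point space 1 is a doubling constant. Hence [1 < p < doubling_dim mu] rules such spaces
    out. *)
Lemma doubling_dim_singleton (x : X) : (forall y, y = x) -> doubling_dim mu <= 0.
Proof.
move=> X1; rewrite /doubling_dim.
suff : doubling_const mu <= 1.
  by move=> C1; rewrite mulr_le0_ge0 ?ln_le0// invr_ge0 ln_ge0// ler1n.
apply: ge_inf; first by exists 0 => C [C0 _]; exact: ltW.
split=> // y r r0; rewrite mul1e; apply: le_outer_measure => z _.
by rewrite (X1 z) (X1 y); exact: ballxx.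
Qed.

(** Suppose all seminorms vanish. The extension of the distance to [x0] then has zero energy on X
    and is, truncated, almost everywhere constant on a ball containing [D]; this forces [D] to be
    [{x0}]. So [x0] is isolated, the truncated distance to it has gradient 0 on X, and a second use
    of the Poincare inequality leaves no other point in X. *)
Lemma exists_nonzero_seminorm D : weak_poincare mu p -> p < doubling_dim mu ->
  extension_domain mu p D ->
  exists2 f, S1p mu p D f & S1p_seminorm mu p D f != 0%E.
Proof.
move=> poin pdim [[[x0 Dx0] oD _] [a [r0 Dr0]] [E [_ ES Eext [C EC]]]].
apply: contrapT => /forall2NP nof.
have {}nof f : S1p mu p D f -> S1p_seminorm mu p D f = 0%E.
  by move=> Sf; have [//|/negP/negPn/eqP] := nof f.
have [N N0 DN] : exists2 N : R, 0 < N & D `<=` ball x0 N.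
  have r00 : 0 < r0.
    by have := Dr0 _ Dx0; rewrite ballEmdist /=; apply: le_lt_trans (mdist_ge0 _ _).
  exists (r0 + r0) => [|y /Dr0 ay]; first by lra.
  by apply: ball_triangle ay; apply: ball_sym; exact: Dr0.
have Sf := N1p_S1p breg p1 balls oD (N1p_mdist N0 oD DN).
have [mh _ /mingradP[wg gfin _]] := ES _ Sf.
pose h y := truncate N (E (mdist x0) y).
have hD y : D y -> h y = mdist x0 y.
  move=> Dy; rewrite /h Eext// truncate_id// ger0_norm ?mdist_ge0//.
  by apply: ltW; have := DN _ Dy; rewrite ballEmdist.
have e0 : energy mu p setT (mingrad mu p setT (E (mdist x0))) = 0%E.
  have := EC _ Sf; rewrite (nof _ Sf) mule0 /S1p_seminorm.
  rewrite (normLp_energy mu p1); last by case: wg => _ + _ y _; apply.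
  move=> le0; apply: (@poweR_eq0_eq0 _ _ p^-1); first exact: energy_ge0.
  by apply/eqP; rewrite eq_le le0 poweR_ge0.
have wh : wug setT h (mingrad mu p setT (E (mdist x0))).
  by apply: weak_upper_gradient_lipschitz wg => y z _ _; exact: truncate_lipschitz.
have hN y : `|h y| <= N by exact: truncate_norm (ltW N0).
have mtr : mu_measurable_fun mu setT h by exact: measurable_truncate.
have [k hk] := poincare_ae_constant breg balls p1 x0 poin mtr hN wh e0 N0.
have nearD y : D y -> exists2 e : R, 0 < e & ball y e `<=` D.
  by move=> Dy; have := open_nbhs_nbhs (conj oD Dy); rewrite -nbhs_ballE => -[e]; exists e.
(* Balls have positive measure, so the almost everywhere identity holds at points arbitrarily close
   to [y]; shrinking to radius [e1] keeps them in [D]. *)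
have near_k y (e : R) : D y -> 0 < e -> exists2 z, mdist y z < e & mdist x0 z = k.
  move=> /nearD[e1 e10 sub] e2; have m0 : 0 < Num.min e e1 by rewrite lt_min e2.
  have [z + hz] := ae_in_ball balls y m0 hk.
  rewrite ballEmdist /= lt_min => /andP[ye ye1]; exists z => //.
  have Dz : D z by apply: sub; rewrite ballEmdist.
  by rewrite -(hD _ Dz); apply: hz; exact: DN.
(* Near [x0] the constant [k] is less than a third of the distance from [x0] to [y], while near [y]
   it exceeds two thirds. *)
have D1 y : D y -> y = x0.
  move=> Dy; apply/eqP; rewrite eq_sym -[_ == _]negbK -mdist_gt0; apply/negP => d0.
  have e30 : 0 < mdist x0 y / 3 by lra.
  have [z xz zk] := near_k x0 _ Dx0 e30.
  have [w yw wk] := near_k y _ Dy e30.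
  have := metric_triangle x0 w y; rewrite (metric_sym w); lra.
have [e e_gt0 sub] := nearD _ Dx0.
have iso : ball x0 e `<=` [set x0] by move=> y /sub /D1.
have far y : y != x0 -> e <= mdist x0 y.
  move=> yx; rewrite leNgt; apply/negP => xy.
  by move/eqP: yx; apply; apply: iso; rewrite ballEmdist.
suff X1 : forall y, y = x0.
  by move: pdim; rewrite ltNge (le_trans (doubling_dim_singleton X1))// ltW.
move=> y; apply/eqP/negPn/negP => /far ey.
have r0' : 0 < mdist x0 y + e by lra.
have mt : mu_measurable_fun mu setT (fun y => truncate e (mdist x0 y)).
  by apply: measurable_truncate; apply: measurable_mdist; exact: openT.
have tN z : `|truncate e (mdist x0 z)| <= e by exact: truncate_norm (ltW e_gt0).
have wt : wug setT (fun y => truncate e (mdist x0 y)) (cst 0%E).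
  exact: weak_upper_gradient_isolated iso.
(* The ball contains the [e]-ball around [y]. The isolated point [x0] has positive measure, which
   forces [k2 = 0], whereas the function takes the value [e] near [y]. *)
have [k2 hk2] := poincare_ae_constant breg balls p1 x0 poin mt tN wt (energy0 _) r0'.
have [z /iso -> ] := ae_in_ball balls x0 e_gt0 hk2.
rewrite mdistxx truncate_id ?normr0 ?(ltW e_gt0)// => k20.
have [w yw] := ae_in_ball balls y e_gt0 hk2.
rewrite -k20 => [|]; last exact: ballxx.
rewrite ballEmdist /= in yw.
have xw : ball x0 (mdist x0 y + e) w.
  by rewrite ballEmdist /=; apply: le_lt_trans (metric_triangle x0 y w) _; rewrite ltrD2l.
have ew : e <= mdist x0 w.
  apply: far; apply/eqP => wx; rewrite wx metric_sym in yw; lra.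
move=> /(_ xw) /eqP; rewrite /truncate min_l// max_r; lra.
Qed.

End Nondegenerate.
(** * The function |x|^(q-2) x and centering *)

Section SignedPower.
Context {R : realType}.
Variable q : R.
Hypothesis q1 : 1 < q.
Implicit Types x c : R.

(** The derivative of $|x|^q/q$. At 0 the factor [x] makes the value 0 even if the exponent [q - 2]
    is negative. *)
Definition signed_pow x : R := `|x| `^ (q - 2) * x.

Let q0 : 0 < q. Proof. exact: lt_trans q1. Qed.
Let qm0 : 0 < q - 1. Proof. by rewrite subr_gt0. Qed.

Lemma norm_signed_pow x : `|signed_pow x| = `|x| `^ (q - 1).
Proof.
rewrite normrM (ger0_norm (powR_ge0 _ _)) mulrC (_ : q - 2 = q - 1 - 1); last by lra.
by rewrite mulr_powRB1.
Qed.

Lemma signed_powM x : signed_pow x * x = `|x| `^ q.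
Proof.
rewrite -(mulr_powRB1 (normr_ge0 x) q0) -(mulr_powRB1 (normr_ge0 x) qm0).
have -> : q - 1 - 1 = q - 2 by lra.
have xx : `|x| * `|x| = x * x by rewrite -normrM ger0_norm// -expr2 sqr_ge0.
by rewrite /signed_pow mulrA xx -mulrA mulrC.
Qed.

Lemma signed_pow_ge0 x : 0 <= x -> 0 <= signed_pow x.
Proof. by move=> x0; rewrite mulr_ge0// powR_ge0. Qed.

Lemma signed_pow_le0 x : x <= 0 -> signed_pow x <= 0.
Proof. by move=> x0; rewrite mulr_ge0_le0// powR_ge0. Qed.

(** The tangent inequality for the convex function $|x|^q$. Write $|x|^q$ as [signed_pow x * (x - c)
    + signed_pow x * c] and apply Young's inequality with exponents q and q/(q-1) to the first
    product: the power of [signed_pow x] is $|x|^q$ again, and absorbing it leaves $|x|^q/q$ on the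
    left. *)
Lemma powR_shift_ge x c : `|x| `^ q <= `|x - c| `^ q + q * c * signed_pow x.
Proof.
have r0 : 0 < q / (q - 1) by rewrite divr_gt0.
have conj : q^-1 + (q / (q - 1))^-1 = 1.
  by rewrite invf_div; field; rewrite gt_eqF.
have := conjugate_powR (normr_ge0 (x - c)) (normr_ge0 (signed_pow x)) q0 r0 conj.
rewrite norm_signed_pow -powRrM mulrCA divff ?gt_eqF// mulr1 => young.
have le1 : `|x| `^ q - signed_pow x * c <= `|x - c| * `|x| `^ (q - 1).
  rewrite -signed_powM -mulrBr (le_trans (ler_norm _))// normrM norm_signed_pow.
  by rewrite mulrC.
set a := `|x| `^ q in young le1 *; set b := `|x - c| `^ q in young *.
have le2 := le_trans le1 young.
have aE : a / (q / (q - 1)) = a - a / q.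
  by rewrite invf_div; field; rewrite gt_eqF.
rewrite aE in le2.
have : a / q <= b / q + signed_pow x * c by lra.
rewrite ler_pdivrMr// mulrDl divfK ?gt_eqF// => /le_trans; apply.
by rewrite (_ : signed_pow x * c * q = q * c * signed_pow x)//; ring.
Qed.

Lemma continuous_signed_pow : continuous signed_pow.
Proof.
(* At 0 the factor with exponent [q - 2] may blow up, so continuity there comes from the norm
   $|x|^{q-1}$ of the product. *)
move=> x; have [->|x0] := eqVneq x 0.
  apply/cvgrPdist_lt => e e0; rewrite [signed_pow 0]mulr0.
  apply/nbhs_ballP; exists (e `^ (q - 1)^-1); first exact: powR_gt0.
  move=> y; rewrite /ball /= !sub0r !normrN norm_signed_pow => ye.
  have <- : (e `^ (q - 1)^-1) `^ (q - 1) = e.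
    by rewrite -powRrM mulVf ?lt0r_neq0// powRr1// ltW.
  by apply: gt0_ltr_powR => //; rewrite nnegrE// powR_ge0.
apply: cvgM; last exact: cvg_id.
apply: (@continuous_comp _ _ _ (fun y : R => `|y|) (fun a : R => a `^ (q - 2))).
  exact: norm_continuous.
apply: differentiable_continuous; apply/derivable1_diffP.
by apply: derivable_powR; rewrite in_itv/= andbT normr_gt0.
Qed.

Lemma measurable_signed_pow d (T : measurableType d) (D : set T) (f : T -> R) :
  measurable_fun D f -> measurable_fun D (fun t => signed_pow (f t)).
Proof.
move=> mf.
exact: (measurableT_comp (continuous_measurable_fun continuous_signed_pow) mf).
Qed.

End SignedPower.

Section Centering.
Context {d} {T : measurableType d} {R : realType}.
Variables (m : {measure set T -> \bar R}) (D : set T) (q : R).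
Hypotheses (q1 : 1 < q) (mD : measurable D) (Dfin : (m D < +oo)%E).

Lemma bounded_norm_integrable (f : T -> R) (M : R) : measurable_fun D f ->
  (forall x, D x -> `|f x| <= M) -> m.-integrable D (EFin \o f).
Proof.
move=> mf fM; apply: measurable_bounded_integrable => //.
exists M; split; first exact: num_real.
by move=> N MN x Dx; exact: le_trans (fM x Dx) (ltW MN).
Qed.

(** Intermediate values: the integrand is nonnegative for c = -N and nonpositive for c = N, and the
    integral is continuous in c by domination. *)
Lemma exists_center (w : T -> R) (N : R) : measurable_fun D w -> 0 < N ->
  (forall x, D x -> `|w x| <= N) ->
  exists c, (\int[m]_(x in D) (signed_pow q (w x - c))%:E = 0)%E.
Proof.
move=> mw N0 wN.
pose f c x := signed_pow q (w x - c).
have mf c : measurable_fun D (f c).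
  by apply: measurable_signed_pow => //; exact: measurable_funB.
pose B := (N + (N + 1)) `^ (q - 1).
have fB c x : `|c| <= N + 1 -> D x -> `|f c x| <= B.
  move=> cN Dx; rewrite norm_signed_pow//; apply: ge0_ler_powR.
  - by rewrite subr_ge0 ltW.
  - by rewrite nnegrE.
  - by rewrite nnegrE; lra.
  by rewrite (le_trans (ler_normB _ _))// lerD ?wN.
have intf c : `|c| <= N + 1 -> m.-integrable D (EFin \o f c).
  by move=> cN; apply: (bounded_norm_integrable (M := B)) => // x Dx; exact: fB.
have I_norm c : `](- N - 1), (N + 1)[%classic c -> `|c| <= N + 1.
  by rewrite /= in_itv/= ler_norml => /andP[? ?]; apply/andP; split; lra.
(* The margin 1 yields an open interval around [-N, N], so that continuity covers the endpoints. *)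
have cont := @continuity_under_integral R d T m f D mD (- N - 1) (N + 1).
have {}cont : {in `](- N - 1), (N + 1)[%classic,
    continuous (fun c => (\int[m]_(x in D) f c x)%R)}.
  apply: (cont _ _ (cst B)).
  - by move=> c /I_norm; exact: intf.
  - apply: aeW => x _ c _; apply: (@continuous_comp _ _ _ (fun c => w x - c) (signed_pow q)).
      by apply: cvgB; [exact: cvg_cst|exact: cvg_id].
    exact: continuous_signed_pow.
  - apply: (bounded_norm_integrable (M := B)) => // x _.
    by rewrite /= ger0_norm// powR_ge0.
  - by move=> c /I_norm cN; apply: aeW => x Dx; exact: fB.
have NN : - N <= N by lra.
have [] := @IVT R (fun c => (\int[m]_(x in D) f c x)%R) (- N) N 0 NN.
- apply: continuous_in_subspaceT => c; rewrite inE /= in_itv/= => /andP[c1 c2].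
  by apply: cont; rewrite inE /= in_itv/=; apply/andP; split; lra.
- rewrite ge_min le_max; apply/andP; split; apply/orP; [right|left].
    have NN1 : `|N| <= N + 1 by rewrite ger0_norm; lra.
    rewrite -lee_fin fineK; last by apply: integrable_fin_num => //; exact: intf.
    apply: (@le_trans _ _ (\int[m]_(x in D) cst 0%E x)%E); last by rewrite integral0.
    apply: le_integral => //; [exact: intf|exact: integrable0|].
    move=> x /set_mem Dx; rewrite lee_fin; apply: signed_pow_le0 => //.
    by rewrite subr_le0 (le_trans (ler_norm _))// wN.
  apply: Rintegral_ge0 => x Dx; apply: signed_pow_ge0 => //.
  by have := wN x Dx; rewrite ler_norml => /andP[? _]; lra.
move=> c; rewrite in_itv/= => /andP[c1 c2] Ic; exists c.
have cN : `|c| <= N + 1 by rewrite ler_norml; apply/andP; split; lra.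
by rewrite -[LHS](fineK (integrable_fin_num mD (intf c cN))); congr EFin.
Qed.

Lemma integral_eq0_integrable (f : T -> R) : measurable_fun D f ->
  (\int[m]_(x in D) (f x)%:E = 0)%E -> m.-integrable D (EFin \o f).
Proof.
move=> mf If; have mEf : measurable_fun D (EFin \o f) by exact/measurable_EFinP.
have [pos_fin neg_fin] : (\int[m]_(x in D) (EFin \o f)^\+ x < +oo)%E /\
    (\int[m]_(x in D) (EFin \o f)^\- x < +oo)%E.
  have p0 : (0 <= \int[m]_(x in D) (EFin \o f)^\+ x)%E by exact: integral_ge0.
  have n0 : (0 <= \int[m]_(x in D) (EFin \o f)^\- x)%E by exact: integral_ge0.
  have : (\int[m]_(x in D) (EFin \o f)^\+ x - \int[m]_(x in D) (EFin \o f)^\- x = 0)%E.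
    by rewrite -integralE.
  move: p0 n0; case: (\int[m]_(x in D) (EFin \o f)^\+ x)%E => [a| |];
    case: (\int[m]_(x in D) (EFin \o f)^\- x)%E => [b| |] //=.
  by rewrite !ltry.
apply/integrableP; split=> //.
apply: (@le_lt_trans _ _
    (\int[m]_(x in D) ((EFin \o f)^\+ x + (EFin \o f)^\- x))%E).
  rewrite le_eqVlt; apply/predU1l; apply: eq_integral => x _.
  exact: (congr1 (fun h : T -> \bar R => h x) (fune_abse (EFin \o f))).
rewrite (ge0_integralD m mD (f1 := (EFin \o f)^\+%E) (f2 := (EFin \o f)^\-%E)) //.
- exact: lte_add_pinfty.
- exact: measurable_funepos.
- exact: measurable_funeneg.
Qed.

End Centering.

Lemma truncate_ge {R : realType} (N a : R) : 0 <= N -> N <= a -> truncate N a = N.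
Proof. by move=> N0 Na; rewrite /truncate min_l// max_r//; lra. Qed.

Lemma truncate_le {R : realType} (N a : R) : 0 <= N -> a <= - N -> truncate N a = - N.
Proof. by move=> N0 Na; rewrite /truncate min_r ?max_l//; lra. Qed.

(** Used to see that the absolute value of a truncation grows with the height, for monotone
    convergence. *)
Lemma truncate_truncate {R : realType} (M N a : R) : 0 <= M -> M <= N ->
  truncate M (truncate N a) = truncate M a.
Proof.
move=> M0 MN; have [Na|aN] := leP N a.
  by rewrite (truncate_ge (a := a)) ?(truncate_ge (N := M)); lra.
have [aN'|Na] := leP a (- N).
  by rewrite (truncate_le (a := a)) ?(truncate_le (N := M)); lra.
by rewrite (truncate_id (N := N))// ler_norml; apply/andP; split; lra.
Qed.

(** * Lower bounds for the $L^q$ norm of shifted truncations *)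

Section LowerBound.
Context {d} {T : measurableType d} {R : realType}.
Variables (m : {measure set T -> \bar R}) (D : set T) (q : R).
Hypotheses (q1 : 1 < q) (mD : measurable D) (Dfin : (m D < +oo)%E).
Variable u : T -> R.
Hypotheses (mu_u : measurable_fun D u)
  (u_centered : (\int[m]_(x in D) (signed_pow q (u x))%:E = 0)%E).

Let q0 : 0 < q. Proof. exact: lt_trans q1. Qed.
Let U n x := truncate n%:R (u x).
Let mU n : measurable_fun D (U n). Proof. exact: measurable_truncate. Qed.

Let measurable_pow (f : T -> R) (s : R) : measurable_fun D f ->
  measurable_fun D (fun x => (`|f x| `^ s)%:E).
Proof.
move=> mf; apply/measurable_EFinP; apply: (measurableT_comp (measurable_powR s)).
exact: measurableT_comp.
Qed.

Let near_U x : \forall n \near \oo, U n x = u x.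
Proof.
exists (Num.truncn `|u x|).+1 => // n /= un; rewrite /U truncate_id//.
by apply: ltW; apply: lt_le_trans (truncnS_gt _) _; rewrite ler_nat.
Qed.

Lemma cvg_integral_truncate :
  (\int[m]_(x in D) (`|truncate n%:R (u x)| `^ q)%:E)%E @[n --> \oo] -->
  (\int[m]_(x in D) (`|u x| `^ q)%:E)%E.
Proof.
rewrite [X in _ --> X](_ : _ =
    (\int[m]_(x in D) (fun x => limn (fun n => (`|U n x| `^ q)%:E)) x)%E).
  apply: cvg_monotone_convergence => //.
  - by move=> n; apply: measurable_pow; exact: mU.
  move=> x _ n k nk; rewrite lee_fin; apply: ge0_ler_powR; rewrite ?nnegrE ?(ltW q0)//.
  by rewrite /U -(@truncate_truncate _ n%:R k%:R) ?ler_nat// truncate_norm_le.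
apply: eq_integral => x _; apply/esym/cvg_lim => //; apply: cvg_near_cst.
by apply: filterS (near_U x) => n ->.
Qed.

(** Dominated convergence: truncation does not increase the norm of [signed_pow], and
    [signed_pow q (u x)] is integrable because its integral is 0 and not infinite. *)
Lemma cvg_signed_pow_truncate :
  fine (\int[m]_(x in D) (signed_pow q (truncate n%:R (u x)))%:E)%E @[n --> \oo] --> (0 : R).
Proof.
suff : (\int[m]_(x in D) (signed_pow q (U n x))%:E)%E @[n --> \oo] -->
    (\int[m]_(x in D) (signed_pow q (u x))%:E)%E.
  by rewrite u_centered => /fine_cvg.
have int_u := integral_eq0_integrable mD (measurable_signed_pow q1 mu_u) u_centered.
have := @dominated_convergence _ _ _ m D mD
  (fun n x => (signed_pow q (U n x))%:E) (fun x => (signed_pow q (u x))%:E)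
  (fun x => `|(signed_pow q (u x))%:E|%E).
case=> //.
- by move=> n; apply/measurable_EFinP; exact: measurable_signed_pow.
- by apply/measurable_EFinP; exact: measurable_signed_pow.
- apply: aeW => x _; apply: cvg_near_cst.
  by apply: filterS (near_U x) => n ->.
- exact: integrable_abse int_u.
apply: aeW => x n _; rewrite /= lee_fin !norm_signed_pow//.
apply: ge0_ler_powR; rewrite ?nnegrE ?subr_ge0 ?(ltW q1)//.
exact: truncate_norm_le.
Qed.

Lemma integral_shift_ge (w : T -> R) (N c : R) : measurable_fun D w ->
  (forall x, D x -> `|w x| <= N) ->
  (\int[m]_(x in D) (`|w x| `^ q)%:E <=
   \int[m]_(x in D) (`|w x - c| `^ q)%:E +
   (q * c * fine (\int[m]_(x in D) (signed_pow q (w x))%:E))%:E)%E.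
Proof.
move=> mw wN.
have mwc : measurable_fun D (fun x => w x - c) by exact: measurable_funB.
have bound (s a b : R) : 0 <= s -> `|a| <= b -> `|a| `^ s <= b `^ s.
  move=> s0 ab; apply: ge0_ler_powR => //; rewrite nnegrE//.
  exact: le_trans ab.
have int_w : m.-integrable D (EFin \o (fun x => signed_pow q (w x))).
  apply: (bounded_norm_integrable mD Dfin (M := N `^ (q - 1))).
    exact: measurable_signed_pow.
  by move=> x Dx; rewrite norm_signed_pow// bound ?wN// subr_ge0 ltW.
have int_wc : m.-integrable D (fun x => (`|w x - c| `^ q)%:E).
  apply: (bounded_norm_integrable mD Dfin (f := fun x => `|w x - c| `^ q)
    (M := (N + `|c|) `^ q)).
    by apply/measurable_EFinP; exact: measurable_pow.
  move=> x Dx; rewrite ger0_norm ?powR_ge0// bound ?(ltW q0)//.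
  by rewrite (le_trans (ler_normB _ _))// lerD ?wN.
have int_pw : m.-integrable D (fun x => (`|w x| `^ q)%:E).
  apply: (bounded_norm_integrable mD Dfin (f := fun x => `|w x| `^ q) (M := N `^ q)).
    by apply/measurable_EFinP; exact: measurable_pow.
  by move=> x Dx; rewrite ger0_norm ?powR_ge0// bound ?wN// ltW.
have int_cw : m.-integrable D (fun x => (q * c)%:E * (signed_pow q (w x))%:E)%E.
  exact: integrableZl.
rewrite EFinM fineK; last exact: integrable_fin_num int_w.
rewrite -(integralZl mD int_w) -(integralD mD int_wc int_cw).
apply: le_integral => //; first exact: integrableD.
by move=> x _; rewrite -EFinM -EFinD lee_fin powR_shift_ge.
Qed.

Lemma sublevel_measure_gt0 : (0 < m D)%E ->
  exists k : nat, (0 < m (D `&` [set x | (`|u x| <= k%:R)%R]))%E.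
Proof.
move=> D0; apply: contrapT => /forallNP none.
pose A (k : nat) := D `&` [set x | (`|u x| <= k%:R)%R].
have mA k : measurable (A k).
  have : measurable_fun D (fun x => `|u x|) by exact: measurableT_comp.
  by move=> /(_ mD _ (measurable_itv `]-oo, k%:R]%R)); congr measurable;
    apply/seteqP; split=> x /=; rewrite in_itv.
have A0 k : m (A k) = 0%E.
  by apply/eqP; rewrite eq_le measure_ge0 andbT leNgt; apply/negP; exact: none.
have : (m D <= \sum_(k <oo) m (A k))%E.
  apply: measure_sigma_subadditive => // x Dx.
  by exists (Num.truncn `|u x|).+1 => //; split=> //=; rewrite ltW// truncnS_gt.
by rewrite eseries0 // leNgt D0.
Qed.

End LowerBound.

Section TruncationLowerBound.
Context {d} {T : measurableType d} {R : realType}.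
Variables (m : {measure set T -> \bar R}) (D : set T) (q : R).
Hypotheses (q1 : 1 < q) (mD : measurable D) (Dfin : (m D < +oo)%E).
Variable u : T -> R.
Hypotheses (mu_u : measurable_fun D u)
  (u_centered : (\int[m]_(x in D) (signed_pow q (u x))%:E = 0)%E).

Let q0 : 0 < q. Proof. exact: lt_trans q1. Qed.

Let measurable_shift_pow N c :
  measurable_fun D (fun x => (`|truncate N (u x) - c| `^ q)%:E).
Proof.
apply/measurable_EFinP; apply: (measurableT_comp (measurable_powR q)).
apply: measurableT_comp => //; apply: measurable_funB => //.
exact: measurable_truncate.
Qed.

(* For a large center c, a sublevel set of u of positive measure suffices. *)
Lemma far_center_ge (L : R) : 0 <= L -> (0 < m D)%E ->
  exists (k : nat) (K : R), 0 <= K /\ forall N c, k%:R <= N -> K <= `|c| ->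
    (L%:E <= \int[m]_(x in D) (`|truncate N (u x) - c| `^ q)%:E)%E.
Proof.
move=> L0 D0; have [k A0] := sublevel_measure_gt0 mD mu_u D0.
pose A := D `&` [set x | (`|u x| <= k%:R)%R].
have mA : measurable A.
  have : measurable_fun D (fun x => `|u x|) by exact: measurableT_comp.
  by move=> /(_ mD _ (measurable_itv `]-oo, k%:R]%R)); congr measurable;
    apply/seteqP; split=> x /=; rewrite in_itv.
have Afin : m A \is a fin_num.
  rewrite ge0_fin_numE//; apply: le_lt_trans Dfin.
  by apply: le_measure; rewrite ?inE//; exact: subIsetl.
have a0 : 0 < fine (m A) by rewrite fine_gt0// A0 ltey_eq Afin.
(* The value at which $r^q$ times the measure of [A] is [L]. On [A] the truncation has norm at most
   [k], so a center of norm at least [k + r] stays at distance [r] from it. *)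
pose r := (L / fine (m A)) `^ q^-1.
have r0 : 0 <= r by exact: powR_ge0.
have rq : r `^ q = L / fine (m A).
  by rewrite -powRrM mulVf ?gt_eqF// powRr1// divr_ge0// ltW.
exists k, (k%:R + r); split; first by rewrite addr_ge0.
move=> N c kN Kc.
apply: (@le_trans _ _ (\int[m]_(x in A) (`|truncate N (u x) - c| `^ q)%:E)%E); last first.
  by apply: ge0_subset_integral => //; exact: subIsetl.
apply: (@le_trans _ _ (\int[m]_(x in A) (cst (r `^ q)%:E x))%E).
  by rewrite integral_cst// -[m A]fineK// -EFinM rq divfK ?gt_eqF.
apply: ge0_le_integral => //.
- by move=> x _; rewrite lee_fin powR_ge0.
- by apply: measurable_funS (measurable_shift_pow N c) => //; exact: subIsetl.
move=> x [_ /= uk]; rewrite lee_fin.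
apply: ge0_ler_powR; rewrite ?nnegrE ?(ltW q0)//.
rewrite truncate_id ?(le_trans uk)// distrC.
by have := lerB_dist c (u x); lra.
Qed.

(** Far centers are settled by [far_center_ge]. For the others c is bounded by [K], and the error
    term of [integral_shift_ge] tends to 0 uniformly in c. *)
Lemma truncate_norm_lower_bound (L : R) :
  (L%:E < \int[m]_(x in D) (`|u x| `^ q)%:E)%E ->
  exists2 N : R, 0 < N &
    forall c, (L%:E <= \int[m]_(x in D) (`|truncate N (u x) - c| `^ q)%:E)%E.
Proof.
move=> Lu; have [L0|L0] := ltP L 0.
  exists 1 => // c; apply: (@le_trans _ _ 0%E); first by rewrite lee_fin ltW.
  by apply: integral_ge0 => x _; rewrite lee_fin powR_ge0.
have D0 : (0 < m D)%E.
  rewrite lt_neqAle measure_ge0 andbT eq_sym; apply/eqP => D0.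
  move: Lu; rewrite null_set_integral//; first by rewrite lte_fin ltNge L0.
  apply/measurable_EFinP; apply: (measurableT_comp (measurable_powR q)).
  exact: measurableT_comp.
have [k [K [K0 far]]] := far_center_ge L0 D0.
(* The gap between [L] and [L'] pays for the error term. *)
have [L' LL' L'u] : exists2 L' : R, L < L' &
    (L'%:E < \int[m]_(x in D) (`|u x| `^ q)%:E)%E.
  move: Lu; case: (\int[m]_(x in D) _)%E => [a| |//].
    by rewrite lte_fin => La; exists ((L + a) / 2); rewrite ?lte_fin; lra.
  by exists (L + 1); rewrite ?ltry//; lra.
(* An integral of [signed_pow] below this threshold, multiplied by [q] and a center below [K], stays
   within [L' - L]; [K + 1] is used because [K] may be 0. *)
have delta0 : 0 < (L' - L) / (q * (K + 1)).
  by rewrite divr_gt0 ?mulr_gt0 ?subr_gt0//; lra.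
have [n1 _ small] : \forall n \near \oo,
    `|fine (\int[m]_(x in D) (signed_pow q (truncate n%:R (u x)))%:E)%E| <
    (L' - L) / (q * (K + 1)).
  by apply: cvgr0_norm_lt => //; exact: cvg_signed_pow_truncate.
have [n2 _ large] : \forall n \near \oo,
    (L'%:E < \int[m]_(x in D) (`|truncate n%:R (u x)| `^ q)%:E)%E.
  have Lnbhs : nbhs (\int[m]_(x in D) (`|u x| `^ q)%:E)%E [set y | (L'%:E < y)%E].
    by apply: open_nbhs_nbhs; split; [exact: open_ereal_gt_ereal|].
  exact: (cvg_integral_truncate q1 mD mu_u Lnbhs).
pose n := (maxn n1 (maxn n2 k)).+1.
exists n%:R; first by rewrite ltr0n.
move=> c; have [Kc|cK] := leP K `|c|.
  by apply: far => //; rewrite ler_nat /n !(leqW, leq_maxr)// !leq_max leqnn !orbT.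
have tn x : D x -> `|truncate n%:R (u x)| <= n%:R by move=> _; exact: truncate_norm.
have shift := integral_shift_ge q1 mD Dfin c (measurable_truncate n%:R mu_u) tn.
have n1n : (n1 <= n)%N by rewrite /n leqW// leq_maxl.
have n2n : (n2 <= n)%N by rewrite /n leqW// leq_max leq_maxl orbT.
have := small n n1n; have /ltW/le_trans/(_ shift) := large n n2n.
move: (fine _) => J /= le1 Jsmall.
move: le1; rewrite -leeBlDr//; apply: le_trans.
rewrite -EFinB lee_fin lerBrDr -lerBrDl.
apply: le_trans (ler_norm _) _; rewrite !normrM (ger0_norm (ltW q0)) -mulrA.
apply: (@le_trans _ _ (q * ((K + 1) * ((L' - L) / (q * (K + 1)))))).
  apply: ler_wpM2l; first exact: ltW.
  by apply: ler_pM => //; [lra|exact: ltW].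
rewrite le_eqVlt; apply/predU1l; field.
by rewrite !gt_eqF//; lra.
Qed.

End TruncationLowerBound.
(** * Comparison of the eigenvalues *)

Section Comparison.
Context {R : realType} {X : pmetricType R}.
Variables (mu : {outer_measure set X -> \bar R}) (p q : R).
Hypotheses (breg : borel_regular mu) (balls : balls_pos_fin mu) (p1 : 1 < p) (q1 : 1 < q).

Local Notation car := (caratheodory_type mu).

Let p0 : 0 < p. Proof. exact: lt_trans p1. Qed.
Let q0 : 0 < q. Proof. exact: lt_trans q1. Qed.

Lemma measure_metric_bounded_lty D : metric_bounded D -> (mu D < +oo)%E.
Proof.
move=> [x [r Dr]]; apply: (@measure_bounded_lty _ _ mu balls D x (Num.max r 1)).
  by rewrite lt_max ltr01 orbT.
by move=> y /Dr; apply: le_ball; rewrite le_max lexx.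
Qed.

Lemma normLp_powR D (s : R) (f : X -> R) : 0 < s ->
  (normLp mu D s (EFin \o f) =
   (\int[cmeasure mu]_(x in D) (`|f x| `^ s)%:E) `^ s^-1)%E.
Proof. by move=> s0; rewrite normLpE// gt_eqF. Qed.

Lemma normLp_eq0 D (s : R) (f : X -> R) : 0 < s -> open D ->
  mu_measurable_fun mu D f ->
  normLp mu D s (EFin \o f) = 0%E <->
  {ae cmeasure mu, forall x, D x -> f x = 0}.
Proof.
move=> s0 oD mf; have mD := open_measurable_car breg oD.
have mfs : measurable_fun (D : set car) (fun x => (`|f x| `^ s)%:E).
  apply/measurable_EFinP; apply: (measurableT_comp (measurable_powR s)).
  exact: measurableT_comp.
have I0 : (0 <= \int[cmeasure mu]_(x in D) (`|f x| `^ s)%:E)%E.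
  by apply: integral_ge0 => x _; rewrite lee_fin powR_ge0.
have absE : (\int[cmeasure mu]_(x in D) `|(`|f x| `^ s)%:E| =
    \int[cmeasure mu]_(x in D) (`|f x| `^ s)%:E)%E.
  by apply: eq_integral => x _; rewrite gee0_abs// lee_fin powR_ge0.
have [aeI aeO] := ae_eq_integral_abs (cmeasure mu) mD mfs.
rewrite normLp_powR//; split.
  move/poweR_eq0_eq0 => /(_ I0); rewrite -absE => /aeI.
  case=> N [mN N0 sub]; exists N; split=> // x /= nf; apply: sub => /= fx.
  by apply: nf => /fx [/powR_eq0_eq0 /eqP]; rewrite normr_eq0 => /eqP.
move=> [N [mN N0 sub]]; rewrite -absE aeO ?poweR0r ?invr_neq0 ?gt_eqF//.
exists N; split=> // x /= nf; apply: sub => /= fx.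
by apply: nf => /fx ->; rewrite normr0 powR0// gt_eqF.
Qed.

Lemma neumann_eigenvalue_ge0 D : (0 <= neumann_eigenvalue mu p q D)%E.
Proof.
apply: le_ereal_inf_tmp => _ [u _ <-].
by rewrite mule_ge0 ?inve_ge0 ?poweR_ge0.
Qed.

(** The test function is the truncation minus the constant of [exists_center]. It is bounded, so it
    has finite norm in every $L^s$, and its seminorm is at most that of [v]. The lower bound is
    required for every c because this constant is not under control. *)
Lemma neumann_eigenvalue_truncate D (v : X -> R) (N L : R) :
  open D -> (mu D < +oo)%E -> S1p mu p D v -> 0 < N -> 0 < L ->
  (forall c, (L%:E <= \int[cmeasure mu]_(x in D) (`|truncate N (v x) - c| `^ q)%:E)%E) ->
  (neumann_eigenvalue mu p q D <=
   S1p_seminorm mu p D v `^ p * ((L `^ (p / q))^-1)%:E)%E.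
Proof.
move=> oD Dfin Sv N0 L0 lower; have [mv _ vmin] := Sv.
have mD := open_measurable_car breg oD.
have mw : measurable_fun (D : set car) (fun x => truncate N (v x)).
  exact: measurable_truncate.
have wN (x : car) : (D : set car) x -> `|truncate N (v x)| <= N.
  by move=> _; exact: truncate_norm (ltW N0).
have [c zc] := @exists_center _ car R (cmeasure mu) D q q1 mD Dfin _ _ mw N0 wN.
pose z x := truncate N (v x) - c.
have mz : mu_measurable_fun mu D z by exact: measurable_funB.
have zM x : D x -> `|z x| <= N + `|c|.
  by move=> Dx; rewrite (le_trans (ler_normB _ _))// lerD2r wN.
have zfin (s : R) : 0 < s -> (normLp mu D s (EFin \o z) < +oo)%E.
  by move=> s0; apply: (bounded_normLp_lty (M := N + `|c|)).
have [wv vfin _] := mingradP vmin.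
have zv x y : D x -> D y -> `|z x - z y| <= `|v x - v y|.
  by move=> _ _; rewrite /z opprB addrA subrK truncate_lipschitz.
have N1z : N1p mu p D z.
  split=> //; first exact: zfin.
  by exists (mingrad mu p D v) => //; exact: weak_upper_gradient_lipschitz wv.
have Qz : ((L `^ q^-1)%:E <= normLp mu D q (EFin \o z))%E.
  rewrite normLp_powR// -poweR_EFin; apply: le_poweR; rewrite ?invr_gt0//.
    by rewrite lee_fin ltW.
  exact: lower.
have Lq0 : 0 < L `^ q^-1 by exact: powR_gt0.
have Qz0 : (0 < normLp mu D q (EFin \o z))%E by rewrite (lt_le_trans _ Qz)// lte_fin.
(* A vanishing $L^p$ norm would mean that [z] is zero almost everywhere, against its positive $L^q$
   norm. *)
have zn0 : N1p_norm mu p D z != 0%E.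
  rewrite gt_eqF// (@lt_le_trans _ _ (normLp mu D p (EFin \o z)))//; last first.
    by rewrite leeDl// normLp_ge0.
  rewrite lt_neqAle normLp_ge0 andbT eq_sym; apply/eqP => /normLp_eq0.
  move=> /(_ p0 oD mz) /(normLp_eq0 q0 oD mz) Q0.
  by rewrite Q0 ltxx in Qz0.
apply: (@le_trans _ _ (normLp mu D p (mingrad mu p D z) `^ p /
    normLp mu D q (EFin \o z) `^ p)%E).
  by apply: ereal_inf_lbound; exists z.
apply: lee_pmul.
- exact: poweR_ge0.
- by rewrite inve_ge0 poweR_ge0.
- by apply: le_poweR => //; [exact: normLp_ge0|exact: S1p_seminorm_lipschitz].
have LE : L `^ (p / q) = (L `^ q^-1) `^ p by rewrite -powRrM mulrC.
have Qzfin : normLp mu D q (EFin \o z) \is a fin_num.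
  by rewrite ge0_fin_numE ?normLp_ge0//; exact: zfin.
move: Qz Qz0; rewrite -[normLp mu D q (EFin \o z)]fineK// => Qz Qz0.
rewrite poweR_EFin inver gt_eqF ?powR_gt0// lee_fin LE lef_pV2 ?posrE ?powR_gt0//.
apply: ge0_ler_powR; rewrite ?nnegrE; [exact: ltW|exact: ltW| |by []].
by rewrite -lee_fin ltW.
Qed.

(** Restricting [E f] to [D] gives back [f] without raising the seminorm, so each quotient is
    positive. A function of nonzero seminorm is needed for there to be a quotient at all: the
    supremum of the empty set is [-oo]. *)
Lemma extension_norm_bounds D D' (E : (X -> R) -> X -> R) :
  weak_poincare mu p -> p < doubling_dim mu -> extension_domain mu p D ->
  open D' -> D `<=` D' -> bounded_extension mu p D D' E ->
  exists2 k : R, 0 < k & extension_norm mu p D D' E = k%:E.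
Proof.
move=> poin pdim extD oD' sub [_ ES Eext [C EC]].
have [[_ oD _] _ _] := extD.
have [f Sf f0] := exists_nonzero_seminorm breg balls p1 poin pdim extD.
have Sfin g : S1p mu p D g -> S1p_seminorm mu p D g \is a fin_num.
  move=> [_ _ /mingradP[_ gfin _]]; rewrite ge0_fin_numE//; exact: normLp_ge0.
have S0 g : (0 <= S1p_seminorm mu p D g)%E by exact: normLp_ge0.
have f_gt0 : (0 < S1p_seminorm mu p D f)%E by rewrite lt_neqAle eq_sym f0 S0.
have ext_ge0 : (0 < S1p_seminorm mu p D' (E f) / S1p_seminorm mu p D f)%E.
  apply: mule_gt0.
    apply: lt_le_trans f_gt0 _.
    by apply: S1p_seminorm_subset (Eext f Sf) => //; exact: ES.
  by rewrite inve_gt0 ?(gt_eqF f_gt0)// -ltey -ge0_fin_numE// Sfin.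
have norm_gt0 : (0 < extension_norm mu p D D' E)%E.
  by apply: (lt_le_trans ext_ge0); apply: ereal_sup_ubound; exists f.
have norm_le : (extension_norm mu p D D' E <= C%:E)%E.
  apply: ge_ereal_sup => _ [g [Sg g0] <-].
  have := EC g Sg; have := Sfin g Sg; have := S0 g; move: g0.
  case: (S1p_seminorm mu p D g) => [a| |] // a0 a_ge0 _ ECg.
  rewrite inver; move: a0; rewrite eqe => /negbTE a0; rewrite a0.
  have {}a0 : 0 < a by rewrite lt_neqAle eq_sym a0 -lee_fin a_ge0.
  by rewrite muleC lee_pdivrMl// muleC.
exists (fine (extension_norm mu p D D' E)).
  by rewrite fine_gt0// norm_gt0 (le_lt_trans norm_le (ltry _)).
by rewrite fineK// ge0_fin_numE ?(le_lt_trans norm_le (ltry _))// ltW.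
Qed.

Lemma seminorm_extension_le D D' (E : (X -> R) -> X -> R) f :
  bounded_extension mu p D D' E -> S1p mu p D f ->
  (S1p_seminorm mu p D' (E f) <=
   extension_norm mu p D D' E * S1p_seminorm mu p D f)%E.
Proof.
move=> [_ ES Eext [C EC]] Sf.
(* The supremum ignores functions of seminorm 0; for these the boundedness of [E] makes the left
   side 0. *)
have [S0|S0] := eqVneq (S1p_seminorm mu p D f) 0%E.
  by have := EC f Sf; rewrite S0 !mule0.
have := ereal_sup_ubound (_ : [set (S1p_seminorm mu p D' (E f) / S1p_seminorm mu p D f)%E
  | f in [set f | S1p mu p D f /\ S1p_seminorm mu p D f != 0%E]]
    (S1p_seminorm mu p D' (E f) / S1p_seminorm mu p D f)%E).
move=> /(_ (ex_intro2 _ _ f (conj Sf S0) erefl)).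
rewrite -/(extension_norm mu p D D' E).
have : (0 <= S1p_seminorm mu p D f)%E by exact: normLp_ge0.
have : (S1p_seminorm mu p D f < +oo)%E by case: Sf => _ _ /mingradP[].
move: S0; case: (S1p_seminorm mu p D f) => [a| |] //; rewrite eqe => a0 _ a_ge0 le1.
have {}a_ge0 : 0 < a by rewrite lt_neqAle eq_sym a0 -lee_fin.
by move: le1; rewrite inver (negbTE a0) muleC lee_pdivrMl// muleC.
Qed.

End Comparison.

Section EigenvalueRatio.
Context {R : realType} {X : pmetricType R}.
Variables (mu : {outer_measure set X -> \bar R}) (p q : R).
Hypotheses (breg : borel_regular mu) (balls : balls_pos_fin mu) (p1 : 1 < p) (q1 : 1 < q).

Local Notation car := (caratheodory_type mu).

Let p0 : 0 < p. Proof. exact: lt_trans p1. Qed.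
Let q0 : 0 < q. Proof. exact: lt_trans q1. Qed.

Lemma ereal_le_of_forall_lt (M : R) (I : \bar R) : 0 <= M ->
  (forall L : R, 0 < L -> (L%:E < I)%E -> L <= M) -> (I <= M%:E)%E.
Proof.
move=> M0 H; rewrite leNgt; apply/negP => MI.
have [L ML LI] : exists2 L : R, M < L & (L%:E < I)%E.
  move: MI; case: I {H} => [a| |] //.
    by rewrite lte_fin => Ma; exists ((M + a) / 2); rewrite ?lte_fin; lra.
  by exists (M + 1); rewrite ?ltry//; lra.
by have := H L (le_lt_trans M0 ML) LI; rewrite leNgt ML.
Qed.

(** Lets L tend to [I]. If [I] is infinite, the right side is 0, and arbitrarily large L force
    [l = 0]. *)
Lemma le_div_poweR (l B : \bar R) (I : \bar R) (s : R) : 0 < s ->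
  (0 <= l)%E -> (0 <= B)%E -> B \is a fin_num -> (0 < I)%E ->
  (forall L : R, 0 < L -> (L%:E < I)%E -> (l <= B * ((L `^ s)^-1)%:E)%E) ->
  (l <= B / I `^ s)%E.
Proof.
move=> s0 l0 + + I0 H; case: B H => [b| |] // H b0 _.
have [->|ln0] := eqVneq l 0%E; first by rewrite mule_ge0// inve_ge0 poweR_ge0.
have [L0 L00 L0I] : exists2 L : R, 0 < L & (L%:E < I)%E.
  move: I0; case: (I) => [a| |] //.
    by rewrite lte_fin => Ia; exists (a / 2); rewrite ?lte_fin; lra.
  by exists 1; rewrite ?ltry.
have lfin : l \is a fin_num.
  by rewrite ge0_fin_numE//; apply: le_lt_trans (H L0 L00 L0I) _; rewrite -EFinM ltry.
case: l l0 ln0 lfin H => [a| |] // a_ge0; rewrite eqe => an0 _ H.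
have a0 : 0 < a by rewrite lt_neqAle eq_sym an0 -lee_fin.
rewrite lee_fin in b0.
have bound (L : R) : 0 < L -> (L%:E < I)%E -> L `^ s <= b / a.
  move=> Lp LI; have := H L Lp LI.
  by rewrite -EFinM lee_fin ler_pdivlMr ?powR_gt0// ler_pdivlMr// mulrC.
have ba0 : 0 <= b / a by rewrite divr_ge0// ltW.
have : (I <= ((b / a) `^ s^-1)%:E)%E.
  apply: ereal_le_of_forall_lt => [|L Lp LI]; first exact: powR_ge0.
  rewrite -[leLHS](powRr1 (ltW Lp)) -(mulfV (lt0r_neq0 s0)) powRrM.
  by apply: ge0_ler_powR; rewrite ?nnegrE ?powR_ge0 ?invr_ge0 ?(ltW s0)// bound.
case: I I0 {H L0I bound} => [i| |] // i0 ib.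
rewrite lte_fin in i0; rewrite poweR_EFin inver gt_eqF ?powR_gt0// -EFinM lee_fin.
rewrite ler_pdivlMr ?powR_gt0// -ler_pdivlMl// mulrC.
rewrite -[leRHS](powRr1 ba0) -(mulVf (lt0r_neq0 s0)) powRrM.
by apply: ge0_ler_powR; rewrite ?nnegrE ?powR_ge0 ?(ltW s0) ?(ltW i0).
Qed.

(** The lower bounds for the truncations of [u] on [D] carry over to those of [v] on [D'], since the
    functions agree on [D] and the integrand is nonnegative on the rest. *)
Lemma neumann_eigenvalue_le_ratio D D' (u v : X -> R) :
  open D -> (mu D < +oo)%E -> open D' -> (mu D' < +oo)%E -> D `<=` D' ->
  mu_measurable_fun mu D u ->
  (\int[cmeasure mu]_(x in D) (signed_pow q (u x))%:E = 0)%E ->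
  (0 < normLp mu D q (EFin \o u))%E ->
  S1p mu p D' v -> (forall x, D x -> v x = u x) ->
  (neumann_eigenvalue mu p q D' <=
   S1p_seminorm mu p D' v `^ p / normLp mu D q (EFin \o u) `^ p)%E.
Proof.
move=> oD Dfin oD' Dfin' sub mu_u u0 Q0 Sv vu.
have mD := open_measurable_car breg oD; have mD' := open_measurable_car breg oD'.
have [mv _ /mingradP[_ vfin _]] := Sv.
rewrite (normLp_powR mu D u q0) -poweRrM [_^-1 * _]mulrC.
apply: le_div_poweR.
- exact: divr_gt0.
- exact: neumann_eigenvalue_ge0.
- exact: poweR_ge0.
- apply: fin_num_poweR; rewrite ge0_fin_numE//; exact: normLp_ge0.
- rewrite (normLp_powR mu D u q0) in Q0.
  apply: gt0_poweR Q0; rewrite ?invr_gt0//.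
  by apply: integral_ge0 => x _; rewrite lee_fin powR_ge0.
move=> L L0 LI.
have [N N0 HN] := @truncate_norm_lower_bound _ car R (cmeasure mu) D q q1 mD Dfin
  u mu_u u0 L LI.
apply: neumann_eigenvalue_truncate N0 L0 _ => // c.
apply: le_trans (HN c) _.
apply: (@le_trans _ _ (\int[cmeasure mu]_(x in D) (`|truncate N (v x) - c| `^ q)%:E)%E).
  rewrite le_eqVlt; apply/predU1l; apply: eq_integral => x /set_mem Dx.
  by rewrite vu.
apply: ge0_subset_integral => //.
apply/measurable_EFinP; apply: (measurableT_comp (measurable_powR q)).
apply: measurableT_comp => //; apply: measurable_funB => //.
exact: measurable_truncate.
Qed.

End EigenvalueRatio.

Theorem theorem4p1 (R : realType) (X : pmetricType R)
    (mu : {outer_measure set X -> \bar R}) (p q : R) (D D' : set X)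
    (E : (X -> R) -> (X -> R)) :
  borel_regular mu -> balls_pos_fin mu ->
  doubling mu -> weak_poincare mu p ->
  1 < p -> p < doubling_dim mu ->
  D `<=` D' -> extension_domain mu p D -> extension_domain mu p D' ->
  1 < q -> q < doubling_dim mu * p / (doubling_dim mu - p) ->
  bounded_extension mu p D D' E ->
  (neumann_eigenvalue mu p q D' <=
     extension_norm mu p D D' E `^ p * neumann_eigenvalue mu p q D)%E.
Proof.
move=> breg balls _ poin p1 pdim sub extD extD' q1 _ bE.
have [[_ oD _] bD _] := extD; have [[_ oD' _] bD' _] := extD'.
have Dfin := measure_metric_bounded_lty balls bD.
have Dfin' := measure_metric_bounded_lty balls bD'.
have p0 : 0 < p by exact: lt_trans p1.
have q0 : 0 < q by exact: lt_trans q1.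
have [k k0 kE] := extension_norm_bounds breg balls p1 poin pdim extD oD' sub bE.
have kp0 : 0 < k `^ p by exact: powR_gt0.
(* Dividing by the positive finite factor isolates the infimum, so that a single [u] can be
   treated. *)
rewrite kE poweR_EFin -lee_pdivrMl//.
apply: le_ereal_inf_tmp => _ [u [Nu n0 u0] <-].
rewrite lee_pdivrMl//.
have Su := N1p_S1p breg p1 balls oD Nu; have [mu_u _ _] := Nu.
(* If [u] vanishes almost everywhere, its nonzero norm comes from the gradient, and the quotient is
   [+oo] since the inverse of 0 is. *)
have [Q0|Q0] := eqVneq (normLp mu D q (EFin \o u)) 0%E.
  have P0 : normLp mu D p (EFin \o u) = 0%E.
    by apply/(normLp_eq0 breg p0 oD mu_u)/(normLp_eq0 breg q0 oD mu_u).
  have G0 : (0 < normLp mu D p (mingrad mu p D u))%E.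
    by rewrite lt_neqAle normLp_ge0 eq_sym andbT; move: n0; rewrite /N1p_norm P0 add0e.
  by rewrite Q0 poweR0r ?gt_eqF// inve0 gt0_muley ?poweR_gt0// gt0_muley ?lte_fin// leey.
have Qpos : (0 < normLp mu D q (EFin \o u))%E by rewrite lt_neqAle eq_sym Q0 normLp_ge0.
have [_ ES Eext _] := bE.
have := neumann_eigenvalue_le_ratio breg p1 q1 oD Dfin oD' Dfin' sub
  mu_u u0 Qpos (ES u Su) (Eext u Su).
move=> /le_trans; apply.
rewrite muleA; apply: lee_wpmul2r; first by rewrite inve_ge0 poweR_ge0.
rewrite -poweR_EFin -poweRM ?normLp_ge0 ?lee_fin ?(ltW k0)//.
apply: le_poweR => //; first exact: normLp_ge0.
by rewrite -kE; exact: seminorm_extension_le bE Su.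
Qed.
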